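(* Let $r\ge 2$ be an integer and let $F$ be an $r$-graph with $m=v(F)$ vertices. Suppose that $F$ is smooth and $(c_1,c_2)$-bounded for constants $c_1,c_2$ satisfying $0<c_1\le \frac{1-\pi(F)}{12m}$ and $c_2>0$. Then there exist $\delta>0$ and $N_0$ such that for every integer $n\ge N_0$ and every integer $t$ with $0\le t\le \frac{\delta\cdot \mathrm{ex}(n,F)}{n^{r-1}}$, $$\mathrm{ar}(n,(t+2)F)=\binom{n}{r}-\binom{n-t}{r}+\mathrm{ar}(n-t,2F).$$
   Context: An $r$-graph is a collection of $r$-subsets (edges) of a finite vertex set; $v(F)$ is the number of vertices of $F$, $|F|$ its number of edges, and $K_n^r$ is the complete $r$-graph on $n$ vertices. For an integer $t\ge1$, $tF$ denotes the $r$-graph consisting of $t$ vertex-disjoint copies of $F$. An edge-colored copy of $tF$ is rainbow if no two of its edges have the same color. For $t\le n/v(F)$, $\mathrm{ar}(n,tF)$ is the minimum integer $N$ such that every surjective edge-coloring $\chi: K_n^r\to[N]$ contains a rainbow copy of $tF$. $\mathrm{ex}(n,F)$ is the maximum number of edges in an $n$-vertex $r$-graph containing no copy of $F$; $\pi(F)=\lim_{n\to\infty}\mathrm{ex}(n,F)/\binom{n}{r}$ is the Turán density; $F$ is degenerate if $\pi(F)=0$. Let $\delta(n,F)=\mathrm{ex}(n,F)-\mathrm{ex}(n-1,F)$ and $d(n,F)=r\cdot\mathrm{ex}(n,F)/n$. The maximum degree $\Delta(\mathcal H)$ of an $r$-graph is the maximum over vertices $v$ of the number of edges containing $v$. $F$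 is $(c_1,c_2)$-bounded if there is $N_0$ such that every $r$-graph $\mathcal H$ on $n\ge N_0$ vertices with $\Delta(\mathcal H)\ge d(n,F)+c_1\binom{n-1}{r-1}$ and $|\mathcal H|\ge(1-c_2)\mathrm{ex}(n,F)$ contains a copy of $F$. $F$ is smooth if either it is degenerate or there is $N_0$ such that $|\delta(n,F)-d(n-1,F)|\le\frac{1-\pi(F)}{8v(F)}\binom{n}{r-1}$ for all $n\ge N_0$. *)

(* Defs.v *)
From HB Require Import structures.
From mathcomp Require Import all_boot all_order all_algebra.
From mathcomp Require Import all_classical all_reals all_analysis.

Set Implicit Arguments.
Unset Strict Implicit.
Unset Printing Implicit Defensive.

Import Order.TTheory GRing.Theory Num.Theory.
Import numFieldNormedType.Exports.

Local Open Scope classical_set_scope.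
Local Open Scope ring_scope.

(** A hypergraph is the set of its edges; its vertex set is the whole carrier
    type, so isolated vertices are allowed and [v(F)] is [#|V|]. *)

Definition is_rgraph (r : nat) (V : finType) (F : {set {set V}}) : bool :=
  [forall e in F, #|e| == r].

Definition contains (V W : finType)
    (F : {set {set V}}) (H : {set {set W}}) : bool :=
  [exists f : {ffun V -> W},
     injectiveb f && [forall e in F, (f @: (e : {set V}))%SET \in H]].

Definition copies (t : nat) (V : finType) (F : {set {set V}}) :
    {set {set ('I_t * V)%type}} :=
  [set ((fun v => (p.1, v)) @: (p.2 : {set V}))%SET
     | p : 'I_t * {set V} & p.2 \in F]%SET.

Definition turan_number (r n : nat) (V : finType) (F : {set {set V}}) : nat :=
  \max_(H : {set {set 'I_n}} | is_rgraph r H && ~~ contains F H) #|H|.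

Definition max_degree (W : finType) (H : {set {set W}}) : nat :=
  \max_(v : W) #|[set e in H | v \in e]%SET|.

(** An edge-coloring of the complete [r]-graph on ['I_n] is a function on all
    subsets of ['I_n]; only its values on [r]-subsets are ever used. *)

Definition surjective_coloring (r n N : nat)
    (chi : {ffun {set 'I_n} -> 'I_N}) : bool :=
  [forall c : 'I_N, exists e : {set 'I_n}, (#|e| == r) && (chi e == c)].

Definition has_rainbow (n N : nat) (chi : {ffun {set 'I_n} -> 'I_N})
    (W : finType) (G : {set {set W}}) : bool :=
  [exists f : {ffun W -> 'I_n}, injectiveb f &&
     [forall e1 in G, forall e2 in G,
        (e1 != e2) ==> (chi (f @: (e1 : {set W}))%SET
                          != chi (f @: (e2 : {set W}))%SET)]].

(** [0 < N] is needed: there is no map from a nonempty set to the empty set of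
    colors, so [N = 0] would qualify vacuously. *)
Definition forces_rainbow (r n : nat) (W : finType) (G : {set {set W}})
    (N : nat) : bool :=
  (0 < N)%N &&
  [forall chi : {ffun {set 'I_n} -> 'I_N},
     surjective_coloring r chi ==> has_rainbow chi G].

Lemma forces_rainbow_ex (r n : nat) (W : finType) (G : {set {set W}}) :
  exists N, forces_rainbow r n G N.
Proof.
exists 'C(n, r).+1; rewrite /forces_rainbow /=; apply/forallP => chi.
apply/implyP => /forallP surj; exfalso.
pose E := [set e : {set 'I_n} | #|e| == r]%SET.
have sub : [set: 'I_('C(n, r).+1)]%SET \subset (chi @: E)%SET.
  apply/fintype.subsetP => c _.
  have /existsP[e /andP[er /eqP <-]] := surj c.
  by apply: imset_f; rewrite inE.
have := leq_trans (subset_leq_card sub) (leq_imset_card _ _).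
by rewrite cardsT card_ord card_draws card_ord ltnn.
Qed.

Definition ar (r n : nat) (W : finType) (G : {set {set W}}) : nat :=
  ex_minn (forces_rainbow_ex r n G).

Section RealParameters.
Variable R : realType.

Definition turan_density (r : nat) (V : finType) (F : {set {set V}}) : R :=
  lim ((fun n : nat => (turan_number r n F)%:R / 'C(n, r)%:R : R) @ \oo).

Definition degenerate (r : nat) (V : finType) (F : {set {set V}}) : Prop :=
  turan_density r F = 0.

Definition ex_increment (r n : nat) (V : finType) (F : {set {set V}}) : R :=
  (turan_number r n F)%:R - (turan_number r n.-1 F)%:R.

Definition ex_avg_degree (r n : nat) (V : finType) (F : {set {set V}}) : R :=
  r%:R * (turan_number r n F)%:R / n%:R.

Definition bounded_graph (r : nat) (V : finType) (F : {set {set V}})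
    (c1 c2 : R) : Prop :=
  exists N0 : nat, forall (W : finType) (H : {set {set W}}),
    let n := #|W| in
    (N0 <= n)%N -> is_rgraph r H ->
    ex_avg_degree r n F + c1 * 'C(n.-1, r.-1)%:R <= (max_degree H)%:R ->
    (1 - c2) * (turan_number r n F)%:R <= (#|H|)%:R ->
    contains F H.

Definition smooth (r : nat) (V : finType) (F : {set {set V}}) : Prop :=
  degenerate r F \/
  exists N0 : nat, forall n : nat, (N0 <= n)%N ->
    `| ex_increment r n F - ex_avg_degree r n.-1 F |
      <= (1 - turan_density r F) / (8%:R * #|V|%:R) * 'C(n, r.-1)%:R.

End RealParameters.

(* Main.v *)
(** Let [chi] use [N = 'C(n, r) - 'C(n - t, r) + ar(n - t, 2F)] colours and have no
    rainbow [(t+2)F]. Choose one edge of each colour to get a graph [G] with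
    [|G| = N >= ex(n, F)], and let [L] be the set of vertices of [G] of degree at
    least [d(n, F) + 2 c1 'C(n-1, r-1)]. Since [F] is bounded, any [j] disjoint
    rainbow copies avoiding [L' <= L] extend greedily to [j + |L'|] of them; hence
    [|L| < t + 2], and [|L|] is neither [t] nor [t + 1], for then few colours would
    occur off [L]. If [l = |L| < t], take a maximal family of [k] disjoint copies of
    [F] in [G - L]; then [k + l <= t + 1], all the vertices used have small degree
    and the rest is [F]-free. Bounding [|G|] accordingly and comparing
    [ex(n - l - k v(F), F)], [ex(n - l, F)] and [ex(n - t, F)] through smoothness
    gives [|G| < N], a contradiction. *)

Require Import Defs.
From HB Require Import structures.
From mathcomp Require Import all_boot all_order all_algebra.
From mathcomp Require Import all_classical all_reals all_analysis.
From mathcomp Require Import zify ring lra.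
From mathcomp Require Import fintype finset.
Set Implicit Arguments.
Unset Strict Implicit.
Unset Printing Implicit Defensive.
Import Order.TTheory GRing.Theory Num.Theory.
Import numFieldNormedType.Exports.
Local Open Scope ring_scope.

(** * Rainbow maps and the defining property of [ar] *)

Lemma imset_preimset (aT rT : finType) (f : aT -> rT) (e : {set rT}) :
  {subset e <= codom f} -> f @: (f @^-1: e) = e.
Proof.
move=> sub; apply/setP => y; apply/imsetP/idP => [[x]|ye].
  by rewrite inE => fx ->.
by have /codomP[x yE] := sub y ye; exists x => //; rewrite inE -yE.
Qed.

Lemma codom_enum_val (T : finType) (U : {set T}) (x : T) :
  (x \in U) = (x \in codom (@enum_val T (mem U))).
Proof.
apply/idP/codomP => [xU|[i ->]]; last exact: enum_valP.
by exists (enum_rank_in xU x); rewrite enum_rankK_in.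
Qed.

Lemma imset_enum_val (T : finType) (U e : {set T}) :
  e \subset U -> (@enum_val T (mem U)) @: ((@enum_val T (mem U)) @^-1: e) = e.
Proof.
by move=> /subsetP eU; apply: imset_preimset => x /eU; rewrite codom_enum_val.
Qed.

Lemma surjection_onto_ord (T : finType) (C : {set T}) (a : nat) :
  (0 < a <= #|C|)%N ->
  exists phi : T -> 'I_a, forall c, exists2 x, x \in C & phi x = c.
Proof.
case: a => // a /= aC.
have /card_gt0P[x0 x0C] : (0 < #|C|)%N by apply: leq_trans aC.
(* Ranks beyond the range get the default value of [inord]; colour [c] is already attained at the
   element of [C] of rank [c]. *)
exists (fun x => inord (enum_rank_in x0C x)) => c.
exists (enum_val (widen_ord aC c)); first exact: enum_valP.
by rewrite enum_valK_in /= inord_val.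
Qed.

(** Colours live in an arbitrary type, so that colourings into [option] or sum types need no
    renumbering. *)
Definition rainbow_map (W0 W : finType) (T : Type) (chi : {set W} -> T)
    (G : {set {set W0}}) (f : W0 -> W) : Prop :=
  injective f /\ {in G &, injective (fun e : {set W0} => chi (f @: e))}.

Lemma has_rainbowP (n N : nat) (chi : {ffun {set 'I_n} -> 'I_N}) (W0 : finType)
    (G : {set {set W0}}) :
  has_rainbow chi G <-> exists f, rainbow_map chi G f.
Proof.
split=> [/existsP[f /andP[/injectiveP inj_f /forall_inP rb]]|[f [inj_f rb]]].
  exists f; split=> // e1 e2 e1G e2G eq12.
  have /forall_inP/(_ _ e2G)/implyP := rb _ e1G.
  by have [//|_ /(_ isT)] := eqVneq e1 e2; rewrite eq12 eqxx.
apply/existsP; exists [ffun x => f x]; apply/andP; split.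
  by apply/injectiveP => x y; rewrite !ffunE => /inj_f.
have imE (e : {set W0}) : [ffun x => f x] @: e = f @: e.
  by apply: eq_imset => x; rewrite ffunE.
apply/forall_inP => e1 e1G; apply/forall_inP => e2 e2G; apply/implyP.
by apply: contra_neq; rewrite !imE => /rb; apply.
Qed.

Lemma ar_spec (r n : nat) (W0 : finType) (G : {set {set W0}}) :
  forces_rainbow r n G (ar r n G) /\
  forall N, forces_rainbow r n G N -> (ar r n G <= N)%N.
Proof. by rewrite /ar; case: (ex_minnP (forces_rainbow_ex r n G)). Qed.

(** Surplus colours are merged by a surjection onto exactly [ar] colours; a copy that is rainbow
    after merging was rainbow before. [enum_val] identifies [U] with the ordinal type on which [ar]
    is defined. *)
Lemma ar_rainbow (r n : nat) (W0 : finType) (G : {set {set W0}}) (T : finType)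
    (U : {set 'I_n}) (chi : {set 'I_n} -> T) :
  (ar r #|U| G <=
     #|chi @: [set e : {set 'I_n} | (#|e| == r) && (e \subset U)]|)%N ->
  exists2 f : W0 -> 'I_n, rainbow_map chi G f & forall x, f x \in U.
Proof.
have [] := ar_spec r #|U| G; move: (ar r #|U| G) => a /andP[a0 /forallP forced] _ aC.
have [phi phi_surj] := surjection_onto_ord (introT andP (conj a0 aC)).
pose h := @enum_val _ (mem U).
have inj_h : injective h by exact: enum_val_inj.
pose chi' := [ffun e : {set 'I_#|U|} => phi (chi (h @: e))].
have surj : surjective_coloring r chi'.
  apply/forallP => c; have [_ /imsetP[e /[!inE] /andP[er eU] ->] <-] := phi_surj c.
  apply/existsP; exists (h @^-1: e).
  by rewrite -(card_imset _ inj_h) ffunE imset_enum_val ?er ?eqxx.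
have := forced chi'; rewrite surj => /has_rainbowP[f [inj_f rb]].
exists (h \o f); last by move=> x; exact: enum_valP.
split=> [|e1 e2 e1G e2G eq12]; first exact: inj_comp.
by apply: rb => //; rewrite !ffunE -!imset_comp eq12.
Qed.

(** As [1 < ar], the number [ar - 1] is positive and fails by minimality because of an actual
    colouring, not because of the convention excluding [N = 0]. *)
Lemma ar_extremal_coloring (r n : nat) (W0 : finType) (G : {set {set W0}}) :
  (1 < ar r n G)%N ->
  exists (N : nat) (chi : {ffun {set 'I_n} -> 'I_N}),
    [/\ N.+1 = ar r n G, surjective_coloring r chi &
        forall f, ~ rainbow_map chi G f].
Proof.
have [_] := ar_spec r n G; case: (ar r n G) => // a amin; rewrite ltnS => a0.
have : ~~ forces_rainbow r n G a by apply/negP => /amin; rewrite ltnn.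
rewrite /forces_rainbow a0 negb_forall => /existsP[chi].
rewrite negb_imply => /andP[surj /negP nrb].
by exists a, chi; split=> // f rb; apply: nrb; apply/has_rainbowP; exists f.
Qed.

Lemma ar_gt0 (r n : nat) (W0 : finType) (G : {set {set W0}}) : (0 < ar r n G)%N.
Proof. by have [/andP[]] := ar_spec r n G. Qed.

(** * Families of disjoint copies *)

(** The copies of a family are indexed by natural numbers, and only the indices
    [i < j] matter. *)
Definition disjoint_copies (V W : finType) (j : nat) (L : {set W})
    (f : nat -> V -> W) : Prop :=
  (forall i i' v v', (i < j)%N -> (i' < j)%N -> f i v = f i' v' ->
     i = i' /\ v = v') /\
  (forall i v, (i < j)%N -> f i v \notin L).

Definition rainbow_copies (V W : finType) (T : Type) (chi : {set W} -> T)
    (F : {set {set V}}) (j : nat) (f : nat -> V -> W) : Prop :=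
  forall i i' (e e' : {set V}), (i < j)%N -> (i' < j)%N -> e \in F -> e' \in F ->
    chi (f i @: e) = chi (f i' @: e') -> i = i' /\ e = e'.

(** A nonempty edge of [copies] determines the copy it lies in, whereas an empty edge would belong
    to all of them; hence equal colours force equal indices. *)
Lemma rainbow_map_copies (V W : finType) (T : Type) (chi : {set W} -> T)
    (F : {set {set V}}) (j : nat) (L : {set W}) (f : 'I_j.+1 * V -> W) :
  {in F, forall e, e != set0} ->
  rainbow_map chi (copies j.+1 F) f -> (forall x, f x \notin L) ->
  exists2 g, disjoint_copies j.+1 L g & rainbow_copies chi F j.+1 g.
Proof.
move=> F_ne0 [inj_f rb] fL; exists (fun i v => f (inord i, v)).
  split=> [i i' v v' ij i'j /inj_f[/(congr1 val)] |i v _ //].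
  by rewrite /= !inordK.
have gE (i : 'I_j.+1) (e : {set V}) :
    (fun v => f (i, v)) @: e = f @: ((fun v => (i, v)) @: e).
  by rewrite -imset_comp.
have inc (k : 'I_j.+1) (e : {set V}) :
    e \in F -> (fun v => (k, v)) @: e \in copies j.+1 F.
  by move=> eF; apply/imsetP; exists (k, e); rewrite ?inE.
move=> i i' e e' ij i'j eF e'F; rewrite !gE => /(rb _ _ (inc _ _ eF) (inc _ _ e'F)).
move=> eq_im; have /set0Pn[v ve] := F_ne0 _ eF.
have : (inord i, v) \in (fun v => (inord i' : 'I_j.+1, v)) @: e'.
  by rewrite -eq_im; apply: imset_f.
case/imsetP => x _ [/(congr1 val)]; rewrite /= !inordK // => ii' _.
split=> //; move: eq_im; rewrite ii'; apply: imset_inj.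
by move=> y z [].
Qed.

Lemma copies_rainbow_map (V W : finType) (T : Type) (chi : {set W} -> T)
    (F : {set {set V}}) (j : nat) (L : {set W}) (g : nat -> V -> W) :
  disjoint_copies j L g -> rainbow_copies chi F j g ->
  rainbow_map chi (copies j F) (fun p : 'I_j * V => g p.1 p.2).
Proof.
move=> [dis _] rb; split.
  by move=> [i v] [i' v'] /= /dis[] // /val_inj -> ->.
move=> e1 e2 /imsetP[[i e] /[!inE] /= eF ->] /imsetP[[i' e'] /[!inE] /= e'F ->].
rewrite -!imset_comp => /rb.
by rewrite !ltn_ord => /(_ isT isT eF e'F) -[ii' ->]; have -> : i = i' by apply: val_inj.
Qed.

(** * Embeddings and restriction to a vertex subset *)

(** The vertices outside [A] are matched, in enumeration order, with points outside [S :|: f @: A];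
    the cardinality hypothesis provides enough of those. *)
Lemma extend_injection (V W : finType) (f : V -> W) (A : {set V}) (S : {set W}) :
  {in A &, injective f} -> (#|S :|: f @: A| + #|~: A| <= #|W|)%N ->
  exists g : V -> W,
    [/\ injective g, {in A, g =1 f} & forall v, v \notin A -> g v \notin S].
Proof.
move=> inj_f leW; pose C := enum (~: (S :|: f @: A)).
pose idx v := index v (enum (~: A)).
have idxP v : v \notin A -> (idx v < size C)%N.
  move=> vA; apply: (@leq_trans #|~: A|).
    by rewrite cardE index_mem mem_enum inE.
  by rewrite -cardE; have := cardsC (S :|: f @: A); lia.
pose g v := if v \in A then f v else nth (f v) C (idx v).
have gC v : v \notin A -> g v \notin S :|: f @: A.
  move=> vA; rewrite /g (negPf vA); have := mem_nth (f v) (idxP _ vA).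
  by rewrite mem_enum inE.
have gA : {in A, g =1 f} by move=> v vA; rewrite /g vA.
exists g; split=> // [v v'|v /gC]; last by rewrite inE negb_or => /andP[].
have [vA|vA] := boolP (v \in A); have [v'A|v'A] := boolP (v' \in A).
- by rewrite !gA //; apply: inj_f.
- by rewrite gA // => eq_g; have := gC _ v'A; rewrite -eq_g inE imset_f ?orbT.
- by rewrite [g v']gA // => eq_g; have := gC _ vA; rewrite eq_g inE imset_f ?orbT.
rewrite /g (negPf vA) (negPf v'A) (set_nth_default (f v) (f v')) ?idxP //.
move/eqP; rewrite nth_uniq ?idxP ?enum_uniq // => /eqP.
move/(congr1 (nth v (enum (~: A)))).
by rewrite !nth_index ?mem_enum ?inE // (set_nth_default v') ?nth_index // ?index_mem mem_enum inE.
Qed.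

Definition embeds_in (V W : finType) (F : {set {set V}}) (H : {set {set W}})
    (U : {set W}) (f : V -> W) : Prop :=
  [/\ injective f, forall v, f v \in U & {in F, forall e : {set V}, f @: e \in H}].

Lemma containsP (V W : finType) (F : {set {set V}}) (H : {set {set W}}) :
  reflect (exists f, embeds_in F H [set: W] f) (contains F H).
Proof.
apply: (iffP existsP) => [[f /andP[/injectiveP inj_f /forall_inP fH]]|].
  by exists f; split=> // v; rewrite inE.
move=> [f [inj_f _ fH]]; exists [ffun x => f x].
have imE (e : {set V}) : [ffun x => f x] @: e = f @: e.
  by apply: eq_imset => x; rewrite ffunE.
apply/andP; split; first by apply/injectiveP => x y; rewrite !ffunE => /inj_f.
by apply/forall_inP => e /fH; rewrite imE.
Qed.

(** Isolated vertices of [F] may be moved off [S], as no edge constrains them. *)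
Lemma embeds_avoiding (V W : finType) (F : {set {set V}}) (H : {set {set W}})
    (S : {set W}) :
  (#|S| + #|V| <= #|W|)%N -> {in H, forall e : {set W}, e \subset ~: S} ->
  contains F H -> exists f, embeds_in F H (~: S) f.
Proof.
move=> leW HS /containsP[f [inj_f _ fH]].
have [|g [inj_g gE gS]] :=
    @extend_injection V W f [set v | f v \notin S] S (in2W inj_f).
  have [leU _] := leq_card_setU S (f @: [set v | f v \notin S]).
  rewrite (card_imset _ inj_f) in leU.
  apply: leq_trans leW; rewrite -(cardsC [set v | f v \notin S]) addnA.
  by rewrite leq_add2r.
exists g; split=> // [v|e eF].
  have [vA|/gS] := boolP (v \in [set v | f v \notin S]); last by rewrite inE.
  by rewrite gE // inE; move: vA; rewrite inE.
have -> : g @: e = f @: e; last exact: fH.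
apply: eq_in_imset => v ve; apply: gE; rewrite inE.
have /subsetP/(_ (f v)) := HS _ (fH _ eF).
by rewrite imset_f // inE => ->.
Qed.

Lemma turan_restrict (r : nat) (V W : finType) (F : {set {set V}})
    (H : {set {set W}}) (U : {set W}) :
  is_rgraph r H -> (forall f, ~ embeds_in F H U f) ->
  (#|[set e in H | e \subset U]| <= turan_number r #|U| F)%N.
Proof.
move=> /forall_inP Hr noF; pose h := @enum_val _ (mem U).
have inj_h : injective h by exact: enum_val_inj.
pose H' := [set e : {set 'I_#|U|} | h @: e \in H].
apply: (@leq_trans #|H'|); last first.
  rewrite /turan_number; apply: (@leq_bigmax_cond _ _ _ H'); apply/andP; split.
    by apply/forall_inP => e; rewrite inE => /Hr; rewrite card_imset.
  apply/containsP => -[f [inj_f _ fH]]; apply: (noF (h \o f)).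
  split=> [|v|e /fH]; [exact: inj_comp | exact: enum_valP | ].
  by rewrite inE -imset_comp.
rewrite -(card_imset _ (imset_inj inj_h)); apply: subset_leq_card.
apply/subsetP => e /[!inE] /andP[eH eU].
by apply/imsetP; exists (h @^-1: e); rewrite ?inE imset_enum_val.
Qed.

(** * Counting [r]-sets *)

Lemma card_rsets_in (T : finType) (r : nat) (U : {set T}) :
  #|[set e : {set T} | (#|e| == r) && (e \subset U)]| = 'C(#|U|, r).
Proof. by rewrite -cards_draws; apply: eq_card => e; rewrite !inE andbC. Qed.

Lemma card_rsets_meeting (T : finType) (r : nat) (L : {set T}) :
  #|[set e : {set T} | (#|e| == r) && ~~ (e \subset ~: L)]|
    = ('C(#|T|, r) - 'C(#|T| - #|L|, r))%N.
Proof.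
have := cardsID [set e : {set T} | e \subset ~: L] [set e : {set T} | #|e| == r].
have -> : [set e : {set T} | #|e| == r] :&: [set e : {set T} | e \subset ~: L]
  = [set e : {set T} | (#|e| == r) && (e \subset ~: L)].
  by apply/setP => e; rewrite !inE.
rewrite card_rsets_in card_draws cardsCs finset.setCK => <-.
by rewrite addKn; apply: eq_card => e; rewrite !inE andbC.
Qed.

Lemma card_rsets_through (T : finType) (r : nat) (x : T) :
  #|[set e : {set T} | (#|e| == r.+1) && (x \in e)]| = 'C(#|T|.-1, r).
Proof.
have T0 : (0 < #|T|)%N by apply/card_gt0P; exists x.
have := card_rsets_meeting r.+1 [set x].
rewrite cards1 subn1; case: #|T| T0 => // N _ /=; rewrite binS addKn => <-.
by apply: eq_card => e; rewrite !inE subsetC finset.sub1set inE negbK.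
Qed.

Definition degree (W : finType) (H : {set {set W}}) (v : W) : nat :=
  #|[set e in H | v \in e]|.

(** * Elementary bounds on Turán numbers *)

Lemma turan_geq (r n : nat) (V : finType) (F : {set {set V}})
    (H : {set {set 'I_n}}) :
  is_rgraph r H -> ~~ contains F H -> (#|H| <= turan_number r n F)%N.
Proof.
move=> Hr HF; rewrite /turan_number.
by apply: (@leq_bigmax_cond _ _ _ H); rewrite Hr.
Qed.

(** Double counting of pairs of an edge and a vertex off it: every edge survives [n.+1 - r] vertex
    deletions, and each of the [n.+1] remaining graphs is [F]-free. *)
Lemma turan_averaging (r n : nat) (V : finType) (F : {set {set V}}) :
  ((n.+1 - r) * turan_number r n.+1 F <= n.+1 * turan_number r n F)%N.
Proof.
rewrite {1}/turan_number; elim/big_ind: _ => [|x y hx hy|H]; rewrite ?muln0 //.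
  by rewrite maxnMr geq_max hx.
case/andP=> Hr HF.
have -> : ((n.+1 - r) * #|H| = \sum_(v : 'I_n.+1) #|[set e in H | e \subset ~: [set v]]|)%N.
  under eq_bigr => v _ do rewrite -sum1_card.
  under eq_bigr => v _ do under eq_bigl => e do rewrite inE.
  rewrite (exchange_big_dep (fun e => e \in H)) /=; last by move=> v e _ /andP[].
  rewrite mulnC -sum_nat_const; apply: eq_bigr => e eH.
  have -> : (n.+1 - r = #|~: e|)%N.
    by have := cardsC e; rewrite card_ord (eqP (forall_inP Hr _ eH)); lia.
  rewrite sum1_card.
  by apply: eq_card => v; rewrite inE [RHS]unfold_in eH subsetC finset.sub1set inE.
have -> : (n.+1 * turan_number r n F = \sum_(v < n.+1) turan_number r n F)%N.
  by rewrite sum_nat_const card_ord.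
apply: leq_sum => v _.
have := @turan_restrict r V _ F H (~: [set v]) Hr.
rewrite cardsC1 card_ord; apply => f [inj_f _ fH].
by case/containsP: HF; exists f; split=> // x; rewrite inE.
Qed.

(** Deleting one vertex destroys at most ['C(n, r)] edges and keeps the graph [F]-free. *)
Lemma turan_succ (r n : nat) (V : finType) (F : {set {set V}}) :
  (turan_number r.+1 n.+1 F <= turan_number r.+1 n F + 'C(n, r))%N.
Proof.
rewrite {1}/turan_number; apply/bigmax_leqP => H /andP[Hr HF].
have := cardsID [set e : {set 'I_n.+1} | ord0 \in e] H => <-.
rewrite addnC leq_add //.
  have := @turan_restrict r.+1 V _ F H (~: [set ord0]) Hr.
  rewrite cardsC1 card_ord.
  have -> : H :\: [set e : {set 'I_n.+1} | ord0 \in e] = [set e in H | e \subset ~: [set ord0]].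
    by apply/setP => e; rewrite !inE subsetC finset.sub1set inE andbC.
  apply => f [inj_f _ fH].
  by case/containsP: HF; exists f; split=> // x; rewrite inE.
have := card_rsets_through r (@ord0 n); rewrite card_ord /= => <-.
apply: subset_leq_card; apply/subsetP => e /[!inE] /andP[eH ->].
by rewrite (eqP (forall_inP Hr _ eH)) eqxx.
Qed.

Lemma turan_le_bin (r n : nat) (V : finType) (F : {set {set V}}) :
  (turan_number r n F <= 'C(n, r))%N.
Proof.
rewrite /turan_number; apply/bigmax_leqP => H /andP[/forall_inP Hr _].
have := card_draws 'I_n r; rewrite card_ord => <-; apply: subset_leq_card.
by apply/subsetP => e eH; rewrite inE Hr.
Qed.

(** Add an isolated vertex to an [F]-free graph. A copy of [F] using it could only place an isolated
    vertex of [F] there, and [#|V| <= n] leaves room to move that vertex elsewhere. *)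
Lemma turan_mono (r n : nat) (V : finType) (F : {set {set V}}) :
  (#|V| <= n)%N -> (turan_number r n F <= turan_number r n.+1 F)%N.
Proof.
move=> Vn; rewrite {1}/turan_number; apply/bigmax_leqP => H /andP[/forall_inP Hr HF].
pose h := widen_ord (leqnSn n).
have inj_h : injective h by move=> x y /(congr1 val) /= /val_inj.
rewrite -(card_imset _ (imset_inj inj_h)); apply: turan_geq.
  by apply/forall_inP => _ /imsetP[e eH ->]; rewrite card_imset ?Hr.
apply/negP => /(@embeds_avoiding _ _ _ _ [set ord_max]) [].
- by rewrite cards1 card_ord.
- move=> _ /imsetP[e eH ->]; rewrite subsetC finset.sub1set inE.
  apply/imsetP => -[x _ /(congr1 val) /= nx].
  by have := ltn_ord x; rewrite -nx ltnn.
move=> f [inj_f fU fH]; case/containsP: HF.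
have fn v : (f v < n)%N.
  have := fU v; rewrite !inE -val_eqE /= => fvn.
  by rewrite ltn_neqAle fvn -ltnS ltn_ord.
have hfE v : h (Ordinal (fn v)) = f v by apply: val_inj.
exists (fun v => Ordinal (fn v)); split=> [x y||e eF].
- by move/(congr1 h); rewrite !hfE => /inj_f.
- by move=> v; rewrite inE.
have := fH e eF; rewrite -(eq_imset _ hfE) imset_comp.
by case/imsetP => e' e'H /(imset_inj inj_h) ->.
Qed.

(** If [F] has at most one edge, a single edge [d] of a large enough graph already carries a copy,
    so the Turán number vanishes. *)
Lemma turan_gt0_card (r n : nat) (V : finType) (F : {set {set V}}) :
  is_rgraph r F -> (#|V| <= n)%N -> (0 < turan_number r n F)%N -> (1 < #|F|)%N.
Proof.
move=> Fr Vn; rewrite ltnNge; apply: contraLR; rewrite negbK -leqNgt => F1.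
rewrite /turan_number; apply/bigmax_leqP => H /andP[Hr]; rewrite leqn0 cards_eq0.
apply: contraNT => /set0Pn[d dH]; apply/containsP.
have dr := eqP (forall_inP Hr _ dH).
have Vn' : (#|V| <= #|'I_n|)%N by rewrite card_ord.
have [F0|/set0Pn[e eF]] := eqVneq F finset.set0.
  exists (fun v => widen_ord Vn (enum_rank v)); split=> [x y|v|e].
  - by move/(congr1 val) => /= /val_inj/enum_rank_inj.
  - by rewrite inE.
  - by rewrite F0 inE.
have er := eqP (forall_inP Fr _ eF).
have ed : (#|e| <= #|d|)%N by rewrite er dr.
(* [f] matches the enumerations of [e] and [d]; its default occurs only outside [e], where
   [extend_injection] replaces it. *)
pose f v := nth (widen_ord Vn (enum_rank v)) (enum d) (index v (enum e)).
have idx v : v \in e -> (index v (enum e) < size (enum d))%N.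
  by move=> ve; rewrite -cardE dr -er cardE index_mem mem_enum.
have fd v : v \in e -> f v \in d.
  by move=> /idx ve; rewrite -mem_enum mem_nth.
have inj_f : {in e &, injective f}.
  move=> x y xe ye; rewrite /f.
  rewrite (set_nth_default (widen_ord Vn (enum_rank x)) (widen_ord Vn (enum_rank y))) ?idx //.
  move/eqP; rewrite nth_uniq ?idx ?enum_uniq // => /eqP/(congr1 (nth x (enum e))).
  by rewrite !nth_index ?mem_enum.
have fed : f @: e = d.
  apply/eqP; rewrite eqEcard card_in_imset // er dr leqnn andbT.
  by apply/subsetP => _ /imsetP[v ve ->]; apply: fd.
have [|g [inj_g gE _]] := @extend_injection V _ f e finset.set0 inj_f.
  by rewrite finset.set0U fed dr -er cardsC.
exists g; split=> // e' e'F.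
have /card_le1_eqP/(_ _ _ eF e'F) -> := F1.
by rewrite (eq_in_imset gE) fed.
Qed.

(** * Lower bounds on anti-Ramsey numbers *)

(** In the constant colouring, two edges of one copy have the same colour. The bound is what makes
    [ar_extremal_coloring] applicable. *)
Lemma ar_copies_gt1 (r n s : nat) (V : finType) (F : {set {set V}}) :
  (r <= n)%N -> (1 < #|F|)%N -> (1 < ar r n (copies s.+1 F))%N.
Proof.
move=> rn /card_gt1P[e1 [e2 [e1F e2F]]]; apply: contraNltn => ar1.
have [|f [_ rb] _] := @ar_rainbow r n _ (copies s.+1 F) unit [set: 'I_n] (fun=> tt).
  rewrite cardsT card_ord (leq_trans ar1) //; apply/card_gt0P; exists tt.
  have : (0 < #|[set e : {set 'I_n} | (#|e| == r) && (e \subset [set: 'I_n])]|)%N.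
    by rewrite card_rsets_in cardsT card_ord bin_gt0.
  by case/card_gt0P => e er; apply/imsetP; exists e.
have inc (e : {set V}) : e \in F -> (fun v => (ord0, v)) @: e \in copies s.+1 F.
  by move=> eF; apply/imsetP; exists (ord0, e); rewrite ?inE.
have /imset_inj -> // := rb _ _ (inc _ e1F) (inc _ e2F) erefl.
by move=> x y [].
Qed.

(** Colour an [F]-free graph injectively and everything else with one further
    colour: one of two disjoint rainbow copies avoids that colour. *)
Lemma turan_lt_ar (r n : nat) (V : finType) (F : {set {set V}}) :
  {in F, forall e, e != finset.set0} ->
  (turan_number r n F < ar r n (copies 2 F))%N.
Proof.
move=> F_ne0; rewrite -(prednK (ar_gt0 r n (copies 2 F))) ltnS.
rewrite /turan_number; apply/bigmax_leqP => H /andP[Hr HF].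
rewrite -ltnS prednK ?ar_gt0 // ltnNge; apply/negP => ar_le.
pose chi (e : {set 'I_n}) := if e \in H then Some e else None.
have [|f rb _] := @ar_rainbow r n _ (copies 2 F) _ [set: 'I_n] chi.
  rewrite cardsT card_ord (leq_trans ar_le) //.
  have inj_Some : injective (@Some {set 'I_n}) by move=> x y [].
  rewrite -(card_imset _ inj_Some); apply: subset_leq_card.
  apply/subsetP => _ /imsetP[e eH ->]; apply/imsetP; exists e.
    by rewrite inE (forall_inP Hr) // finset.subsetT.
  by rewrite /chi eH.
have [|g [dis _] rbg] := rainbow_map_copies (L := finset.set0) F_ne0 rb.
  by move=> x; rewrite inE.
have off i : (i < 2)%N -> exists2 e, e \in F & chi (g i @: e) = None.
  move=> i2; have : ~~ [forall e in F, g i @: (e : {set V}) \in H].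
    apply: contra HF => /forall_inP gH; apply/containsP; exists (g i).
    by split=> [x y /dis[]|v|e /gH].
  by rewrite negb_forall_in => /exists_inP[e eF /negPf eH]; exists e; rewrite // /chi eH.
have [e eF ce] := off 0 isT; have [e' e'F ce'] := off 1 isT.
by have [] : 0%N = 1%N /\ e = e' by apply: rbg; rewrite ?ce ?ce'.
Qed.

(** Give distinct private colours to all edges meeting a [t]-set: at most [t]
    disjoint copies meet that set. *)
Lemma ar_copies_lower (r n s t : nat) (V : finType) (F : {set {set V}}) :
  {in F, forall e, e != finset.set0} -> (t <= n)%N ->
  (1 < ar r (n - t) (copies s.+1 F))%N ->
  ('C(n, r) - 'C(n - t, r) + ar r (n - t) (copies s.+1 F)
     <= ar r n (copies (s + t).+1 F))%N.
Proof.
move=> F_ne0 tn /ar_extremal_coloring[N [chi0 [<- surj nrb]]].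
rewrite addnS ltnNge; apply/negP => ar_le.
pose h := widen_ord (leq_subr t n).
have inj_h : injective h by move=> x y /(congr1 val) /= /val_inj.
pose U : {set 'I_n} := [set x : 'I_n | (x < n - t)%N].
have UE : U = h @: [set: 'I_(n - t)].
  apply/setP => x; rewrite inE; apply/idP/imsetP => [xn|[y _ ->]]; last exact: (ltn_ord y).
  by exists (Ordinal xn); rewrite ?inE //; apply: val_inj.
have cardU : #|U| = (n - t)%N by rewrite UE card_imset // cardsT card_ord.
have cardUC : #|~: U| = t by have := cardsC U; rewrite cardU card_ord; lia.
pose chi (e : {set 'I_n}) : {set 'I_n} + 'I_N :=
  if e \subset U then inr (chi0 (h @^-1: e)) else inl e.
have chi_h (e : {set 'I_(n - t)}) : chi (h @: e) = inr (chi0 e).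
  rewrite /chi UE imsetS ?finset.subsetT //; congr (inr (chi0 _)).
  by apply/setP => x; rewrite inE mem_imset.
have [|f rb _] := @ar_rainbow r n _ (copies (s + t).+1 F) _ [set: 'I_n] chi.
  rewrite cardsT card_ord (leq_trans ar_le) //.
  pose A : {set {set 'I_n}} := [set e : {set 'I_n} | (#|e| == r) && ~~ (e \subset ~: ~: U)].
  have -> : ('C(n, r) - 'C(n - t, r) + N
      = #|inl @: A :|: inr @: [set: 'I_N] : {set {set 'I_n} + 'I_N}|)%N.
    rewrite cardsU (_ : _ :&: _ = finset.set0) ?cards0 ?subn0; last first.
      apply/setP => x; rewrite !inE; apply/negP => /andP[/imsetP[y _ ->]].
      by case/imsetP.
    rewrite !card_imset ?cardsT ?card_ord; try by move=> ? ? [].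
    by rewrite card_rsets_meeting cardUC card_ord.
  apply: subset_leq_card; apply/subsetP => x /setUP[] /imsetP[y].
    rewrite inE finset.setCK => /andP[yr yU] ->; apply/imsetP; exists y.
      by rewrite inE yr finset.subsetT.
    by rewrite /chi (negPf yU).
  move=> _ ->; have /existsP[e /andP[er /eqP <-]] := forallP surj y.
  apply/imsetP; exists (h @: e); last by rewrite chi_h.
  by rewrite inE card_imset // er finset.subsetT.
have [|g dis rbg] := rainbow_map_copies (L := finset.set0) F_ne0 rb.
  by move=> x; rewrite inE.
pose I := [set i : 'I_(s + t).+1 | [forall v, g i v \in U]].
have cardI : (s < #|I|)%N.
  suff : (#|~: I| <= t)%N by have := cardsC I; rewrite card_ord; lia.
  have [->|/set0Pn[i0]] := eqVneq (~: I) finset.set0; first by rewrite cards0.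
  rewrite !inE negb_forall => /existsP[v0 _].
  (* [v0] is only a default: for [i] outside [I], [w i] is a vertex that copy [i] places off [U].
     Disjointness makes these images distinct. *)
  pose w (i : 'I_(s + t).+1) := odflt v0 [pick v | g i v \notin U].
  have wP i : i \in ~: I -> g i (w i) \notin U.
    rewrite finset.in_setC [i \in I]inE negb_forall /w => /existsP[v vU].
    by case: pickP => [//|/(_ v)]; rewrite vU.
  rewrite -(@card_in_imset _ _ (fun i : 'I_(s + t).+1 => g i (w i))).
    rewrite -[X in (_ <= X)%N]cardUC; apply: subset_leq_card; apply/subsetP.
    by move=> _ /imsetP[i iI ->]; rewrite finset.in_setC wP.
  move=> i i' _ _ /dis.1; rewrite !ltn_ord => /(_ isT isT) -[ii' _].
  exact: val_inj.
(* Renumber [s.+1] of the copies inside [U] consecutively, as [disjoint_copies] expects; they would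
   be rainbow for [chi0]. *)
pose idx (i : nat) : nat := nth 0%N [seq val x | x <- enum I] i.
have size_idx : size [seq val x | x <- enum I] = #|I| by rewrite size_map -cardE.
have idxP i : (i < s.+1)%N -> (idx i < (s + t).+1)%N /\ forall v, g (idx i) v \in U.
  move=> is1; have : idx i \in [seq val x | x <- enum I].
    by rewrite mem_nth // size_idx (leq_trans is1).
  case/mapP => k; rewrite mem_enum inE => /forallP kU ->.
  by split=> [|v]; [exact: (ltn_ord k) | exact: kU].
have inj_idx i i' : (i < s.+1)%N -> (i' < s.+1)%N -> idx i = idx i' -> i = i'.
  move=> is1 i's1 /eqP.
  rewrite nth_uniq ?size_idx ?(leq_trans is1) ?(leq_trans i's1) //; first by move/eqP.
  by rewrite map_inj_uniq ?enum_uniq //; apply: val_inj.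
have dis' : disjoint_copies s.+1 finset.set0 (fun i => g (idx i)).
  split=> [i i' v v' is1 i's1|i v _]; last by rewrite inE.
  by case/dis.1 => [||/inj_idx -> //]; [case: (idxP i) | case: (idxP i')].
have rb' : rainbow_copies chi F s.+1 (fun i => g (idx i)).
  move=> i i' e e' is1 i's1 eF e'F.
  by case/rbg => // [||/inj_idx -> //]; [case: (idxP i) | case: (idxP i')].
have [inj_k rbk] := copies_rainbow_map dis' rb'.
have kU (p : 'I_s.+1 * V) : (g (idx p.1) p.2 < n - t)%N.
  by have [//|_ /(_ p.2)] := idxP p.1; rewrite inE.
have hk p : h (Ordinal (kU p)) = g (idx p.1) p.2 by apply: val_inj.
apply: (nrb (fun p => Ordinal (kU p))); split=> [x y /(congr1 h)|e1 e2 e1F e2F].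
  by rewrite !hk => /inj_k.
have imE (e : {set 'I_s.+1 * V}) :
    (fun p : 'I_s.+1 * V => g (idx p.1) p.2) @: e = h @: ((fun p => Ordinal (kU p)) @: e).
  by rewrite -imset_comp; apply: eq_imset => p /=; rewrite hk.
by move=> eq_chi; apply: rbk => //; rewrite !imE !chi_h eq_chi.
Qed.

(** * Greedy extension and maximal families of copies *)

Definition used_vertices (V W : finType) (j : nat) (f : nat -> V -> W) : {set W} :=
  [set f p.1 p.2 | p : 'I_j * V].

Lemma mem_used_vertices (V W : finType) (j : nat) (f : nat -> V -> W) i v :
  (i < j)%N -> f i v \in used_vertices j f.
Proof. by move=> ij; apply/imsetP; exists (Ordinal ij, v). Qed.

Lemma card_used_vertices (V W : finType) (j : nat) (L : {set W}) (f : nat -> V -> W) :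
  disjoint_copies j L f -> #|used_vertices j f| = (j * #|V|)%N.
Proof.
move=> [dis _]; rewrite card_imset ?card_prod ?card_ord //.
move=> [i v] [i' v'] /= /dis.
by rewrite !ltn_ord => /(_ isT isT) -[ii' ->]; have -> : i = i' by apply: val_inj.
Qed.

(** The forbidden set may shrink from [L] to [L']: in the greedy extension the new copy is allowed
    to use the vertex just removed from it. *)
Lemma add_copy (V W : finType) (j : nat) (L L' : {set W}) (f : nat -> V -> W)
    (g : V -> W) :
  disjoint_copies j L f -> injective g -> L' \subset L ->
  (forall v, g v \notin L' :|: used_vertices j f) ->
  disjoint_copies j.+1 L' (fun i => if i == j then g else f i).
Proof.
move=> [dis fL] inj_g /subsetP LL' gU.
have gf i v v' : (i < j)%N -> g v' <> f i v.
  move=> ij eq_g; have := gU v'.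
  by rewrite inE negb_or eq_g mem_used_vertices // andbF.
split=> [i i' v v'|i v].
  rewrite !ltnS; have [-> _|ij ij'] := eqVneq i j; have [-> _|i'j i'j'] := eqVneq i' j.
  - by move/inj_g.
  - by move/gf; case; rewrite ltn_neqAle i'j.
  - by move/esym/gf; case; rewrite ltn_neqAle ij.
  - by apply: dis; rewrite ltn_neqAle ?ij ?i'j.
rewrite ltnS; have [_ _|ij ij'] := eqVneq i j.
  by have := gU v; rewrite inE negb_or => /andP[].
by apply: contra (fL i v _); [exact: LL' | rewrite ltn_neqAle ij].
Qed.

(** Greedily, each vertex of [L'] yields one further copy of [F], off the earlier
    copies, off the rest of [L'] and off the colours already used. *)
Lemma extend_rainbow_copies (n J : nat) (V T : finType) (F : {set {set V}})
    (chi : {set 'I_n} -> T) (G : {set {set 'I_n}}) (L : {set 'I_n}) :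
  {in G &, injective chi} -> (J * #|V|.+1 + #|V| <= n)%N ->
  (forall v (S : {set 'I_n}) (C : {set {set 'I_n}}),
      v \in L -> v \notin S -> (#|S| <= J * #|V|.+1)%N -> (#|C| <= J * #|F|)%N ->
      contains F [set e in G | (e \subset ~: S) && (e \notin C)]) ->
  forall (L' : {set 'I_n}) (j : nat) (f : nat -> V -> 'I_n),
    L' \subset L -> (j + #|L'| = J)%N ->
    disjoint_copies j L' f -> rainbow_copies chi F j f ->
    exists2 f', disjoint_copies J finset.set0 f' & rainbow_copies chi F J f'.
Proof.
move=> inj_chi nJ richL L' j f; move: {2}#|L'| (erefl #|L'|) => l.
elim: l => [|l IHl] in L' j f *.
  move/eqP; rewrite cards_eq0 => /eqP->; rewrite cards0 addn0 => _ <-.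
  by exists f.
move=> cardL' L'L jJ dis rb.
have /card_gt0P[v vL'] : (0 < #|L'|)%N by rewrite cardL'.
have cardL'v : #|L' :\ v| = l by have := cardsD1 v L'; rewrite vL' cardL'; lia.
pose S := (L' :\ v) :|: used_vertices j f.
pose colors := [set chi (f p.1 @: p.2) | p : 'I_j * {set V} & p.2 \in F].
(* The earlier copies need not lie in [G], so their colours are excluded rather than their edges. As
   [chi] is injective on [G], each colour removes at most one edge. *)
pose C := [set e in G | chi e \in colors].
have cardS : (#|S| <= J * #|V|.+1)%N.
  have [+ _] := leq_card_setU (L' :\ v) (used_vertices j f).
  rewrite -/S (card_used_vertices dis) cardL'v => /leq_trans -> //.
  by rewrite mulnS -jJ cardL' mulnDl; nia.
have cardC : (#|C| <= J * #|F|)%N.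
  rewrite -(@card_in_imset _ _ chi); last first.
    by move=> x y /[!inE] /andP[xG _] /andP[yG _]; apply: inj_chi.
  apply: (@leq_trans #|colors|).
    by apply: subset_leq_card; apply/subsetP => _ /imsetP[e /[!inE] /andP[_ ?] ->].
  apply: leq_trans (leq_imset_card _ _) _.
  have -> : [set p : 'I_j * {set V} | p.2 \in F] = setX [set: 'I_j] F.
    by apply/setP => p; rewrite !inE.
  by rewrite cardsX cardsT card_ord leq_mul2r -jJ leq_addr orbT.
have vS : v \notin S.
  rewrite !inE eqxx /=; apply/negP => /imsetP[p _ vE].
  by have := dis.2 p.1 p.2; rewrite ltn_ord -vE vL' => /(_ isT).
have := richL v S C (subsetP L'L _ vL') vS cardS cardC.
case/(embeds_avoiding (S := S)) => [||g [inj_g gS gG]].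
- by rewrite card_ord; lia.
- by move=> e; rewrite inE => /and3P[].
apply: (IHl (L' :\ v) j.+1 (fun i => if i == j then g else f i)) => //.
- by apply: fintype.subset_trans L'L; apply: finset.subsetDl.
- by rewrite cardL'v; lia.
- by apply: add_copy dis inj_g (finset.subsetDl _ _) _ => u; have := gS u; rewrite inE.
have new i e e' : (i < j)%N -> e \in F -> e' \in F -> chi (g @: e) <> chi (f i @: e').
  move=> ij eF e'F eq_chi; have := gG _ eF; rewrite !inE => /and3P[gG' _].
  rewrite gG' /=; case/negP; rewrite eq_chi.
  by apply/imsetP; exists (Ordinal ij, e'); rewrite ?inE.
have chi_g e e' : e \in F -> e' \in F -> chi (g @: e) = chi (g @: e') -> e = e'.
  move=> /gG /[!inE] /andP[eG _] /gG /[!inE] /andP[e'G _].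
  by move/(inj_chi _ _ eG e'G)/(imset_inj inj_g).
move=> i i' e e'.
rewrite !ltnS; have [-> _|ij ij'] := eqVneq i j; have [-> _|i'j i'j'] := eqVneq i' j.
- by move=> eF e'F /chi_g ->.
- by move=> eF e'F /new; case=> //; rewrite ltn_neqAle i'j.
- by move=> eF e'F /esym/new; case=> //; rewrite ltn_neqAle ij.
- by apply: rb; rewrite ltn_neqAle ?ij ?i'j.
Qed.

(** Greedy growth up to the cap [K]: a family that stops earlier does so because the remaining
    vertices span no copy. [w0] provides the values of the empty family. *)
Lemma maximal_copies (V W : finType) (F : {set {set V}}) (H : {set {set W}})
    (L : {set W}) (w0 : W) (K : nat) :
  exists k f, [/\ (k <= K)%N, disjoint_copies k L f,
    forall i, (i < k)%N -> {in F, forall e : {set V}, f i @: e \in H} &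
    (k < K)%N -> forall g, ~ embeds_in F H (~: (L :|: used_vertices k f)) g].
Proof.
elim: K => [|K [k [f [kK dis fH nog]]]]; first by exists 0%N, (fun _ _ => w0).
have [kK'|kK'] := ltnP k K.
  by exists k, f; split=> // [|_]; [lia | apply: nog].
have [[g [inj_g gU gH]]|no] :=
    pselect (exists g, embeds_in F H (~: (L :|: used_vertices k f)) g); last first.
  by exists k, f; split=> // [|_ g gE]; [lia | apply: no; exists g].
exists k.+1, (fun i => if i == k then g else f i); split; [lia | | | lia].
  by apply: add_copy dis inj_g _ _ => // v; have := gU v; rewrite inE.
move=> i; rewrite ltnS; have [//|ik ik'] := eqVneq i k.
by apply: fH; rewrite ltn_neqAle ik.
Qed.

(** * Reduction to a degree condition and a numerical inequality *)

(** Every edge meets [L], or meets [U], or lies in the [F]-free rest; the three summands bound these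
    classes in turn. *)
Lemma card_split_edges (r n : nat) (V : finType) (F : {set {set V}})
    (G : {set {set 'I_n}}) (L U : {set 'I_n}) :
  is_rgraph r G -> [disjoint L & U] ->
  (forall f, ~ embeds_in F G (~: (L :|: U)) f) ->
  (#|G| <= 'C(n, r) - 'C(n - #|L|, r) + \sum_(v in U) degree G v
           + turan_number r (n - #|L| - #|U|) F)%N.
Proof.
move=> Gr dLU noF; have /forall_inP Gr' := Gr.
have -> : (n - #|L| - #|U| = #|~: (L :|: U)|)%N.
  have := cardsC (L :|: U); have [_] := leq_card_setU L U.
  by rewrite dLU card_ord => /eqP ->; lia.
apply: leq_trans (leq_add (leqnn _) (turan_restrict Gr noF)).
rewrite -(cardsID [set e : {set 'I_n} | e \subset ~: (L :|: U)] G) addnC leq_add //; last first.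
  by apply: subset_leq_card; apply/subsetP => e; rewrite !inE.
pose A := [set e : {set 'I_n} | (#|e| == r) && ~~ (e \subset ~: L)].
have -> : ('C(n, r) - 'C(n - #|L|, r) = #|A|)%N by rewrite card_rsets_meeting card_ord.
pose B := \bigcup_(v in U) [set e in G | v \in e].
apply: (@leq_trans #|A :|: B|); last first.
  have [le _] := leq_card_setU A B; apply: leq_trans le _.
  by rewrite leq_add2l /B; elim/big_rec2: _ => [|v x y _ IH];
    rewrite ?cards0 // (leq_trans (leq_card_setU _ _).1) // leq_add2l.
apply: subset_leq_card; apply/subsetP => e /setDP[eG]; rewrite !inE.
rewrite finset.setCU finset.subsetI negb_and Gr' //= => /orP[-> //|].
case/subsetPn => v ve; rewrite inE negbK => vU; apply/orP; right.
by apply/bigcupP; exists v; rewrite ?inE ?eG.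
Qed.

Lemma rainbow_transversal (T0 T : finType) (chi : T0 -> T) (A : {set T0}) :
  exists G : {set T0}, [/\ G \subset A, {in G &, injective chi} & #|G| = #|chi @: A|].
Proof.
pose p c := [pick e in A | chi e == c].
pose G := [set e in A | p (chi e) == Some e].
have inj : {in G &, injective chi}.
  move=> x y /[!inE] /andP[_ /eqP px] /andP[_ /eqP py] eq_xy.
  by have [] : Some x = Some y by rewrite -px -py eq_xy.
exists G; split=> //; first by apply/subsetP => e /[!inE] /andP[].
rewrite -(card_in_imset inj); congr #|pred_of_set _|; apply/setP => c.
apply/imsetP/imsetP => [[e /[!inE] /andP[eA _] ->]|[e eA cE]]; first by exists e.
have [d pd /andP[dA /eqP dc]] : exists2 d, p c = Some d & (d \in A) && (chi d == c).
  by rewrite /p; case: pickP => [d dP|/(_ e)]; [by exists d | rewrite eA cE eqxx].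
by exists d => //; rewrite inE dA dc pd eqxx.
Qed.

(** Iterated [turan_succ]. Together with [turan_lt_ar] it shows that a graph with one edge per
    colour has at least [ex(n, F)] edges. *)
Lemma turan_add_bin (r n t : nat) (V : finType) (F : {set {set V}}) :
  (t <= n)%N ->
  (turan_number r.+1 n F + 'C(n - t, r.+1)
     <= turan_number r.+1 (n - t) F + 'C(n, r.+1))%N.
Proof.
elim: t => [|t IHt] tn; first by rewrite subn0.
have := IHt (ltnW tn); have -> : (n - t = (n - t.+1).+1)%N by lia.
by have := turan_succ r (n - t.+1) F; rewrite (binS (n - t.+1)); lia.
Qed.

Lemma subset_of_card (T : finType) (A : {set T}) (k : nat) :
  (k <= #|A|)%N -> exists2 B : {set T}, B \subset A & #|B| = k.
Proof.
move=> kA; exists [set x in take k (enum A)].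
  by apply/subsetP => x; rewrite inE => /mem_take; rewrite mem_enum.
by rewrite cardsE (card_uniqP _) ?take_uniq ?enum_uniq // size_takel // -cardE.
Qed.

(** Distinct edges of a disjoint family are distinct edges of [G], on which [chi] is injective;
    nonemptiness lets an edge recover its copy. *)
Lemma disjoint_copies_rainbow (V W T : finType) (F : {set {set V}})
    (chi : {set W} -> T) (G : {set {set W}}) (L : {set W}) k (f : nat -> V -> W) :
  {in F, forall e, e != finset.set0} -> {in G &, injective chi} ->
  disjoint_copies k L f ->
  (forall i, (i < k)%N -> {in F, forall e : {set V}, f i @: e \in G}) ->
  rainbow_copies chi F k f.
Proof.
move=> F_ne0 inj_chi [dis _] fG i i' e e' ik i'k eF e'F.
move/(inj_chi _ _ (fG i ik e eF) (fG i' i'k e' e'F)) => eq_im.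
have /set0Pn[v ve] := F_ne0 _ eF.
have /imsetP[v' _ /dis[] // ii' _] : f i v \in f i' @: e'.
  by rewrite -eq_im imset_f.
split=> //; move: eq_im; rewrite -ii'; apply: imset_inj => x y.
by case/dis.
Qed.

(** The combinatorial half of the argument. Analysis enters only through the threshold [D]: vertices
    of degree at least [D] must yield copies robustly, and the last hypothesis must hold when fewer
    than [t] such vertices exist. *)
Lemma ar_copies_eq (R : realType) (r n t : nat) (V : finType) (F : {set {set V}})
    (D : R) :
  {in F, forall e, e != finset.set0} -> (1 < #|F|)%N ->
  (t.+2 * #|V|.+1 + #|V| <= n)%N -> (r.+1 + t.+1 <= n)%N ->
  (forall (G : {set {set 'I_n}}) v (S : {set 'I_n}) (C : {set {set 'I_n}}),
      is_rgraph r.+1 G -> (turan_number r.+1 n F <= #|G|)%N ->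
      D <= (degree G v)%:R -> v \notin S ->
      (#|S| <= t.+2 * #|V|.+1)%N -> (#|C| <= t.+2 * #|F|)%N ->
      contains F [set e in G | (e \subset ~: S) && (e \notin C)]) ->
  (forall l k : nat, (l < t)%N -> (k + l <= t.+1)%N ->
      (k * #|V|)%:R * D + (turan_number r.+1 (n - l - k * #|V|) F)%:R
        + 'C(n - t, r.+1)%:R
      <= 'C(n - l, r.+1)%:R + (turan_number r.+1 (n - t) F)%:R) ->
  ar r.+1 n (copies t.+2 F)
    = ('C(n, r.+1) - 'C(n - t, r.+1) + ar r.+1 (n - t) (copies 2 F))%N.
Proof.
move=> F_ne0 F1 Jn rtn rich count; apply/eqP; rewrite eqn_leq andbC.
rewrite (@ar_copies_lower _ _ 1) ?ar_copies_gt1 //=; [|lia..].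
set N := (_ + _)%N.
have binN : ('C(n - t, r.+1) <= 'C(n, r.+1))%N by apply: leq_bin2l; lia.
have turanN := turan_lt_ar r.+1 (n - t) F_ne0.
apply: (ar_spec _ _ _).2; rewrite /forces_rainbow addn_gt0 ar_gt0 orbT /=.
apply/forallP => chi; apply/implyP => /forallP surj.
have [//|nrb] := boolP (has_rainbow chi (copies t.+2 F)); exfalso.
pose A := [set e : {set 'I_n} | #|e| == r.+1].
have [G [/subsetP GA inj_chi]] := rainbow_transversal chi A.
have -> : chi @: A = [set: 'I_N].
  apply/setP => c; rewrite inE; have /existsP[e /andP[er /eqP <-]] := surj c.
  by rewrite imset_f // inE.
rewrite cardsT card_ord => cardG.
have Gr : is_rgraph r.+1 G by apply/forall_inP => e /GA; rewrite inE.
have turanG : (turan_number r.+1 n F <= #|G|)%N.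
  by have := @turan_add_bin r n t V F; rewrite cardG /N; lia.
pose L := [set v | D <= (degree G v)%:R].
have richL v (S : {set 'I_n}) (C : {set {set 'I_n}}) :
    v \in L -> v \notin S -> (#|S| <= t.+2 * #|V|.+1)%N ->
    (#|C| <= t.+2 * #|F|)%N ->
    contains F [set e in G | (e \subset ~: S) && (e \notin C)].
  by rewrite inE => vL vS cardS cardC; apply: rich vL vS cardS cardC.
have norain (L' : {set 'I_n}) j f : L' \subset L -> (j + #|L'| = t.+2)%N ->
    disjoint_copies j L' f -> rainbow_copies chi F j f -> False.
  move=> L'L jL' dis rb.
  have [g disg rbg] := extend_rainbow_copies inj_chi Jn richL L'L jL' dis rb.
  case/negP: nrb; apply/has_rainbowP; exists (fun p : 'I_t.+2 * V => g p.1 p.2).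
  exact: copies_rainbow_map disg rbg.
have w0 : 'I_n by exists 0%N; lia.
have [Lt|Lt] := leqP t.+2 #|L|.
  have [L' L'L cardL'] := subset_of_card Lt.
  by apply: (norain L' 0%N (fun _ _ => w0)).
have cardLC : #|~: L| = (n - #|L|)%N by have := cardsC L; rewrite card_ord; lia.
have [tL|tL] := leqP t #|L|.
  pose s := (t.+1 - #|L|)%N.
  have [|f rb fL] := @ar_rainbow r.+1 n _ (copies s.+1 F) _ (~: L) chi.
    (* Here [s.+1] is 2 or 1. Applied on [n - t] vertices, of which [#|L| - t] are removed, the
       lower bound shows that the colours occurring off [L] still force [s.+1] rainbow copies
       there. *)
    have := @ar_copies_lower r.+1 (n - t) s (#|L| - t) V F F_ne0.
    have -> : (n - t - (#|L| - t) = n - #|L|)%N by lia.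
    have -> : ((s + (#|L| - t)).+1 = 2)%N by lia.
    rewrite ar_copies_gt1 //; last by lia.
    rewrite cardLC => /(_ _ isT) low.
    pose A1 := [set e : {set 'I_n} | (#|e| == r.+1) && (e \subset ~: L)].
    pose A2 := [set e : {set 'I_n} | (#|e| == r.+1) && ~~ (e \subset ~: L)].
    have : (#|[set: 'I_N]| <= #|chi @: A1| + #|chi @: A2|)%N.
      apply: leq_trans (leq_card_setU _ _).1; apply: subset_leq_card.
      apply/subsetP => c _; have /existsP[e /andP[er /eqP <-]] := surj c.
      rewrite inE; have [eL|eL] := boolP (e \subset ~: L).
        by rewrite imset_f // inE er.
      by rewrite orbC imset_f // inE er.
    have := leq_imset_card chi A2; rewrite card_rsets_meeting cardsT !card_ord.
    have := leq_bin2l r.+1 (leq_subr (#|L| - t) (n - t)).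
    have -> : (n - t - (#|L| - t) = n - #|L|)%N by lia.
    by rewrite /N -/A1; lia.
  have [|g dis rbg] := rainbow_map_copies (L := L) F_ne0 rb.
    by move=> x; have := fL x; rewrite inE.
  by apply: (norain L s.+1 g) => //; lia.
have [k [f [kK dis fG nog]]] := maximal_copies F G L w0 (t.+2 - #|L|).
have rb := disjoint_copies_rainbow F_ne0 inj_chi dis fG.
have [kK'|kK'] := ltnP k (t.+2 - #|L|); last by apply: (norain L k f) => //; lia.
have dLU : [disjoint L & used_vertices k f].
  rewrite disjoint_sym disjoint_subset; apply/subsetP => _ /imsetP[p _ ->].
  by rewrite inE; apply: dis.2.
have := card_split_edges Gr dLU (nog kK').
rewrite cardG (card_used_vertices dis).
have sumD : ((\sum_(v in used_vertices k f) degree G v)%:R : R)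
    <= (k * #|V|)%:R * D.
  rewrite -(card_used_vertices dis) -sum1_card !natr_sum mulr_suml.
  apply: ler_sum => v vU; rewrite mul1r ltW // ltNge.
  have /disjointFl/(_ vU) := dLU.
  by rewrite inE => ->.
have lt_kl : (k + #|L| <= t.+1)%N by lia.
have cnt := count _ _ tL lt_kl.
have binL : ('C(n - t, r.+1) <= 'C(n - #|L|, r.+1))%N by apply: leq_bin2l; lia.
have binL' : ('C(n - #|L|, r.+1) <= 'C(n, r.+1))%N by apply: leq_bin2l; lia.
set sd := (\sum_(v in _) _)%N in sumD *; set tu := turan_number _ _ _ in cnt *.
(* The counting hypothesis is not strict; the contradiction comes from the strict inequality
   [turanN]. *)
move=> leN; have : (sd + tu + 'C(n - t, r.+1) <=
    'C(n - #|L|, r.+1) + turan_number r.+1 (n - t) F)%N.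
  by rewrite -(ler_nat R) !natrD; lra.
by move: leN; rewrite /N; lia.
Qed.

(** * Binomial estimates *)

Lemma ffact_le_expn (n k : nat) : (n ^_ k <= n ^ k)%N.
Proof.
rewrite ffact_prod -[X in (_ <= _ ^ X)%N](card_ord k) -prod_nat_const.
by apply: leq_prod => i _; apply: leq_subr.
Qed.

Lemma expn_le_ffact (n k : nat) : ((n - k) ^ k <= n ^_ k)%N.
Proof.
rewrite ffact_prod -[X in (_ ^ X <= _)%N](card_ord k) -prod_nat_const.
by apply: leq_prod => i _; rewrite leq_sub2l // ltnW.
Qed.

Lemma bin_le_expr (R : realType) (n p k : nat) :
  (p <= n)%N -> 'C(p, k)%:R <= n%:R ^+ k / k`!%:R :> R.
Proof.
move=> pn; rewrite ler_pdivlMr ?ltr0n ?fact_gt0 // -natrM bin_ffact -natrX ler_nat.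
by apply: leq_trans (ffact_le_expn _ _) _; case: k => // k; rewrite leq_exp2r.
Qed.

Lemma bernoulli_ineq (R : realType) (x : R) (k : nat) :
  0 <= x <= 1 -> 1 - k%:R * x <= (1 - x) ^+ k.
Proof.
move=> /andP[x0 x1]; elim: k => [|k IHk]; first by rewrite expr0; lra.
rewrite exprS; apply: le_trans (ler_wpM2l _ IHk); last lra.
rewrite -[k.+1]addn1 natrD; have : 0 <= k%:R * (x * x) by rewrite mulr_ge0 ?mulr_ge0.
nra.
Qed.

(** Each factor of the falling factorial is at least [p - k], hence at least [(1 - 2 x) n]: one [x]
    pays for [n - p], the other for [k]. Bernoulli's inequality then bounds the power. *)
Lemma bin_ge_expr (R : realType) (n p k : nat) (x : R) :
  0 <= x -> 2 * x <= 1 -> (1 - x) * n%:R <= p%:R -> k%:R <= x * n%:R ->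
  (1 - 2 * k%:R * x) * (n%:R ^+ k / k`!%:R) <= 'C(p, k)%:R :> R.
Proof.
move=> x0 x1 px kx; rewrite mulrA ler_pdivrMr ?ltr0n ?fact_gt0 //.
rewrite -[leRHS]natrM bin_ffact; apply: (@le_trans _ _ ((p - k) ^ k)%:R); last first.
  by rewrite ler_nat expn_le_ffact.
have n0 : 0 <= n%:R :> R by [].
have kp : (k <= p)%N by rewrite -(ler_nat R); nra.
rewrite natrX natrB //; apply: (@le_trans _ _ (((1 - 2 * x) * n%:R) ^+ k)).
  rewrite exprMn; apply: ler_wpM2r; first exact: exprn_ge0.
  have := @bernoulli_ineq R (2 * x) k; rewrite mulrCA mulrA; apply.
  by apply/andP; split; lra.
by apply: lerXn2r; rewrite ?nnegrE; nra.
Qed.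

(** * Convergence to the Turán density *)

Lemma turan_ratio_step (R : realType) (r n : nat) (V : finType)
    (F : {set {set V}}) : (r <= n)%N ->
  (turan_number r n.+1 F)%:R / 'C(n.+1, r)%:R
    <= (turan_number r n F)%:R / 'C(n, r)%:R :> R.
Proof.
move=> rn; have C0 : 0 < 'C(n, r)%:R :> R by rewrite ltr0n bin_gt0.
have C1 : 0 < 'C(n.+1, r)%:R :> R by rewrite ltr0n bin_gt0 ltnW.
rewrite ler_pdivrMr // mulrAC ler_pdivlMr // -!natrM ler_nat.
have avg := turan_averaging r n F.
have binE : ((n.+1 - r) * 'C(n.+1, r) = n.+1 * 'C(n, r))%N.
  by rewrite -mul_bin_down.
rewrite -(leq_pmul2l (_ : 0 < n.+1)%N) //.
rewrite mulnCA -binE mulnCA mulnA [leqRHS]mulnA.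
by rewrite leq_mul2r avg orbT.
Qed.

(** [turan_density] is a [lim], informative only once convergence is known. The ratios decrease from
    index [r] on; before it the denominators vanish, hence the shift. *)
Lemma turan_ratio_cvg (R : realType) (r : nat) (V : finType) (F : {set {set V}}) :
  ((fun n : nat => (turan_number r n F)%:R / 'C(n, r)%:R : R) @ \oo
     --> turan_density R r F)%classic.
Proof.
set u := (X in (X @ _ --> _)%classic).
have shift_cvg : cvgn [sequence u (n + r)%N]_n.
  apply: nonincreasing_is_cvgn.
    by apply/nonincreasing_seqP => n; apply: turan_ratio_step; rewrite leq_addl.
  by exists 0 => _ [n _ <-]; rewrite /u divr_ge0.
have u_cvg : (u @ \oo --> lim ([sequence u (n + r)%N]_n @ \oo))%classic.
  by rewrite -(cvg_shiftn r).
by rewrite /turan_density -/u (cvg_lim _ u_cvg).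
Qed.

(** * The counting inequality *)

Lemma telescope_ge (R : realType) (u : nat -> R) (g : R) (lo hi : nat) :
  (lo <= hi)%N ->
  (forall p, (lo <= p)%N -> (p < hi)%N -> g <= u p.+1 - u p) ->
  (hi - lo)%:R * g <= u hi - u lo.
Proof.
move=> /subnKC <-; move: (hi - lo)%N => k; rewrite addKn.
elim: k => [|k IHk] step; first by rewrite addn0 mul0r subrr.
have {}IHk : k%:R * g <= u (lo + k)%N - u lo.
  by apply: IHk => p lop plt; apply: step => //; lia.
have := step (lo + k)%N (leq_addr _ _); rewrite addnS ltnSn => /(_ isT).
by rewrite -[k.+1]addn1 natrD mulrDl mul1r; lra.
Qed.

(** [e], [b], [d] stand for [ex(., F)], ['C(., r)] and the average degree, and
    [a] for [1 - pi(F)]. Per unit of [Y], each of the [k] removed copies costs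
    about [(1/6 + 1/8) a], while each of the [t - l >= k / 2] missing vertices of
    full degree would gain about [(1 - 1/8) a]. *)
Lemma count_ineq (R : realType) (e b d : nat -> R) (a x ep Y D : R)
    (m n t l k : nat) :
  (0 < m)%N -> (l < t)%N -> (k + l <= t.+1)%N -> ((2 * m + 1) * t <= n)%N ->
  let M := ((2 * m + 1) * t)%N in
  0 <= Y -> 0 <= a -> 2 * m%:R * x + 2 * ep <= 7 * a / 24 ->
  0 <= x ->
  D <= d n + a / (6 * m%:R) * Y ->
  (forall p, (n - M <= p)%N -> (p < n)%N ->
     `|e p.+1 - e p - d p| <= a / (8 * m%:R) * Y) ->
  (forall p, (n - M <= p)%N -> (p < n)%N -> d n - x * Y <= d p) ->
  (forall p, (n - M <= p)%N -> (p < n)%N -> d p <= (1 - a + ep) * Y) ->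
  (forall p, (n - M <= p)%N -> (p < n)%N -> (1 - ep) * Y <= b p.+1 - b p) ->
  (k * m)%:R * D + e (n - l - k * m)%N + b (n - t)%N
    <= b (n - l)%N + e (n - t)%N.
Proof.
move=> m0 lt kl Mn M Y0 a0 small x0 Dle Hs Hlow Hup Hb.
have m0R : 1 <= m%:R :> R by rewrite ler1n.
(* As [l < t], [k <= t + 1 <= 2 t], so [M] bounds the number of vertices ever deleted. *)
have kmM : (l + k * m <= M)%N by rewrite /M; nia.
have tM : (t <= M)%N by rewrite /M; nia.
pose c := a / m%:R; have aE : a = c * m%:R by rewrite /c divfK //; lra.
have c0 : 0 <= c by rewrite divr_ge0 //; lra.
have c8 : a / (8 * m%:R) = c / 8 by rewrite /c; field; lra.
have c6 : a / (6 * m%:R) = c / 6 by rewrite /c; field; lra.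
rewrite c6 in Dle.
have T1 := @telescope_ge R e (d n - x * Y - c / 8 * Y) (n - l - k * m) (n - l) (leq_subr _ _).
have {}T1 : (k * m)%:R * (d n - x * Y - c / 8 * Y) <= e (n - l)%N - e (n - l - k * m)%N.
  move: T1; rewrite (_ : (n - l - (n - l - k * m) = k * m)%N); last by lia.
  apply => p p1 p2; have pM : (n - M <= p)%N by lia.
  have pn : (p < n)%N by lia.
  have := Hs p pM pn; rewrite c8 ler_norml => /andP[+ _].
  by have := Hlow p pM pn; lra.
have nlt : (n - t <= n - l)%N by lia.
have T2 := @telescope_ge R (fun p => b p - e p) ((7 * a / 8 - 2 * ep) * Y) _ _ nlt.
have {}T2 : (t - l)%:R * ((7 * a / 8 - 2 * ep) * Y)
    <= b (n - l)%N - e (n - l)%N - (b (n - t)%N - e (n - t)%N).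
  move: T2; rewrite (_ : (n - l - (n - t) = t - l)%N); last by lia.
  apply => p p1 p2; have pM : (n - M <= p)%N by lia.
  have pn : (p < n)%N by lia.
  have := Hs p pM pn; rewrite c8 ler_norml => /andP[_ +].
  have := Hup p pM pn; have := Hb p pM pn.
  have : c / 8 * Y <= a / 8 * Y by apply: ler_wpM2r => //; rewrite aE; nra.
  lra.
(* [k <= t - l + 1 <= 2 (t - l)], again by [l < t]. *)
have km2 : (k * m)%:R <= 2 * (t - l)%:R * m%:R :> R.
  by rewrite -!natrM ler_nat; nia.
have step1 : (k * m)%:R * (D - (d n - x * Y - c / 8 * Y))
    <= (k * m)%:R * ((7 * c / 24 + x) * Y).
  by apply: ler_wpM2l => //; lra.
have step2 : (k * m)%:R * ((7 * c / 24 + x) * Y)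
    <= 2 * (t - l)%:R * m%:R * ((7 * c / 24 + x) * Y).
  by apply: ler_wpM2r km2; rewrite mulr_ge0 //; lra.
(* Twice [m] times [7 c / 24] is [7 a / 12], which falls short of [7 a / 8] by [7 a / 24], the room
   granted to the error terms in [small]. *)
have step3 : 2 * (t - l)%:R * m%:R * ((7 * c / 24 + x) * Y)
    <= (t - l)%:R * ((7 * a / 8 - 2 * ep) * Y).
  rewrite [leLHS](_ : _ = (t - l)%:R * ((7 * a / 12 + 2 * m%:R * x) * Y)); last first.
    by rewrite aE; field.
  by apply: ler_wpM2l => //; apply: ler_wpM2r => //; lra.
move: step1; rewrite mulrBr; lra.
Qed.

(** * Density and smoothness for large orders *)

Lemma turan_le_density (R : realType) (r : nat) (V : finType) (F : {set {set V}})
    (ep : R) : 0 < ep ->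
  exists N, forall p, (N <= p)%N ->
    (turan_number r p F)%:R <= (turan_density R r F + ep) * 'C(p, r)%:R.
Proof.
move=> ep0; have /cvgrPdist_le/(_ ep ep0)[N _ HN] := @turan_ratio_cvg R r V F.
exists N => p Np; have := HN p Np; rewrite /= ler_norml => /andP[+ _].
have [C0|] := posnP 'C(p, r).
  by have := turan_le_bin r p F; rewrite C0 leqn0 => /eqP -> _; rewrite mulr0.
by rewrite -(ltr0n R) => C0 le_ep; rewrite -ler_pdivrMr //; lra.
Qed.

Lemma turan_density_ge0 (R : realType) (r : nat) (V : finType) (F : {set {set V}}) :
  0 <= turan_density R r F.
Proof.
apply/ler_addgt0Pr => ep /(@turan_le_density R r V F)[N HN].
have := HN (N + r)%N (leq_addr _ _).
have C0 : 0 < 'C(N + r, r)%:R :> R by rewrite ltr0n bin_gt0 leq_addl.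
move=> /(le_trans (ler0n _ _)); rewrite pmulr_lge0 //.
Qed.

(** ['C(p, r)] is the degree in the complete graph on [p.+1] vertices, so a density bound transfers
    to average degrees. *)
Lemma ex_avg_degree_le (R : realType) (r p : nat) (V : finType)
    (F : {set {set V}}) (c : R) :
  (turan_number r.+1 p.+1 F)%:R <= c * 'C(p.+1, r.+1)%:R ->
  ex_avg_degree R r.+1 p.+1 F <= c * 'C(p, r)%:R.
Proof.
have diag : (p.+1 * 'C(p, r) = r.+1 * 'C(p.+1, r.+1))%N := mul_bin_diag p.+1 r.
move=> le_c; rewrite /ex_avg_degree ler_pdivrMr //.
rewrite -[leRHS]mulrA -[X in _ <= c * X]natrM.
by rewrite (mulnC 'C(p, r)) diag natrM mulrCA ler_wpM2l.
Qed.

(** For a degenerate [F] averaging gives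
    [0 <= ex(n+1) - ex(n) <= d(n+1) = o(n^(r-1))], so the smoothness inequality
    holds as well. *)
Lemma smooth_increment (R : realType) (r : nat) (V : finType) (F : {set {set V}}) :
  smooth R r.+1 F -> (0 < #|V|)%N ->
  exists N0 : nat, forall n : nat, (N0 <= n)%N ->
    `| (turan_number r.+1 n.+1 F)%:R - (turan_number r.+1 n F)%:R
         - ex_avg_degree R r.+1 n F |
      <= (1 - turan_density R r.+1 F) / (8%:R * #|V|%:R) * 'C(n.+1, r)%:R.
Proof.
move=> [deg|[N HN]] V0; last first.
  by exists N => n Nn; have := HN n.+1 (leqW Nn).
set c := (_ / _); have c0 : 0 < c.
  by rewrite /c (deg : turan_density R _ F = 0) subr0 div1r invr_gt0 mulr_gt0 ?ltr0n.
have [N HN] := @turan_le_density R r.+1 V F c c0.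
exists (N + #|V| + 1)%N => -[|n] Nn; first lia.
have avg_le k : (n <= k <= n.+1)%N -> ex_avg_degree R r.+1 k.+1 F <= c * 'C(n.+2, r)%:R.
  move=> /andP[nk kn]; apply: (@le_trans _ _ (c * 'C(k, r)%:R)).
    apply: ex_avg_degree_le; have := HN k.+1; rewrite (deg : turan_density R _ F = 0).
    by rewrite add0r; apply; lia.
  apply: ler_wpM2l; first exact: ltW.
  by rewrite ler_nat leq_bin2l //; lia.
have d0 k : 0 <= ex_avg_degree R r.+1 k F by rewrite /ex_avg_degree divr_ge0 ?mulr_ge0.
have mono : (turan_number r.+1 n.+1 F)%:R <= (turan_number r.+1 n.+2 F)%:R :> R.
  by rewrite ler_nat turan_mono //; lia.
have incr : (turan_number r.+1 n.+2 F)%:R - (turan_number r.+1 n.+1 F)%:R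
    <= ex_avg_degree R r.+1 n.+2 F.
  rewrite /ex_avg_degree ler_pdivlMr // mulrBl -!natrM lerBlDr -natrD ler_nat.
  have := turan_averaging r.+1 n.+1 F; rewrite mulnBl; nia.
have := avg_le n; have := avg_le n.+1.
rewrite !leqnn !leqnSn => /(_ isT) avg1 /(_ isT) avg0.
have := d0 n.+1; rewrite ler_norml => d1; apply/andP; split; lra.
Qed.

(** * Effect of deleting few edges or vertices *)

Lemma bin_le_expn (n k : nat) : ('C(n, k) <= n ^ k)%N.
Proof.
apply: leq_trans (ffact_le_expn n k).
by rewrite -bin_ffact leq_pmulr // fact_gt0.
Qed.

Lemma card_rsets_through2 (T : finType) (k : nat) (v w : T) : v != w ->
  (#|[set e : {set T} | [&& #|e| == k.+2, v \in e & w \in e]]| <= #|T| ^ k)%N.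
Proof.
move=> vw; apply: leq_trans (bin_le_expn _ _); rewrite -card_draws.
apply: leq_trans (leq_imset_card (fun e => v |: (w |: e)) _).
apply: subset_leq_card; apply/subsetP => e /[!inE] /and3P[/eqP ek ve we].
have wev : w \in e :\ v by rewrite !inE eq_sym vw.
apply/imsetP; exists (e :\ v :\ w); last by rewrite setD1K // setD1K.
rewrite inE; have := cardsD1 v e; have := cardsD1 w (e :\ v).
by rewrite ve wev ek; lia.
Qed.

Lemma card_bigcup_leq (I T : finType) (S : {set I}) (B : I -> {set T}) (K : nat) :
  (forall i, i \in S -> #|B i| <= K)%N ->
  (#|\bigcup_(i in S) B i| <= #|S| * K)%N.
Proof.
move=> BK; rewrite -sum_nat_const.
elim/big_rec2: _ => [|i x y iS IH]; first by rewrite cards0.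
by apply: leq_trans (leq_card_setU _ _).1 _; rewrite leq_add // BK.
Qed.

(** Deleting the edges that meet [S] or lie in [C] lowers the degree of [v] by at most
    [(#|S| + #|C|) n ^ q], since [v] is off [S], and the size by at most [(#|S| + #|C|) n ^ q.+1].
    One of the two [c1] terms and the slack [c2] absorb these losses. *)
Lemma contains_off_set (R : realType) (q n : nat) (V : finType)
    (F : {set {set V}}) (c1 c2 : R) (G : {set {set 'I_n}}) (v : 'I_n)
    (S : {set 'I_n}) (C : {set {set 'I_n}}) :
  (forall H : {set {set 'I_n}},
     is_rgraph q.+2 H ->
     ex_avg_degree R q.+2 n F + c1 * 'C(n.-1, q.+1)%:R <= (max_degree H)%:R ->
     (1 - c2) * (turan_number q.+2 n F)%:R <= #|H|%:R -> contains F H) ->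
  is_rgraph q.+2 G -> (turan_number q.+2 n F <= #|G|)%N ->
  ex_avg_degree R q.+2 n F + 2 * c1 * 'C(n.-1, q.+1)%:R <= (degree G v)%:R ->
  v \notin S ->
  (#|S| + #|C|)%:R * n%:R ^+ q <= c1 * 'C(n.-1, q.+1)%:R ->
  (#|S| + #|C|)%:R * n%:R ^+ q.+1 <= c2 * (turan_number q.+2 n F)%:R ->
  contains F [set e in G | (e \subset ~: S) && (e \notin C)].
Proof.
move=> bounded Gr Gex Gv vS small1 small2.
have n0 : (0 < n)%N by apply: leq_ltn_trans (ltn_ord v).
set H := [set e in G | _].
have split_e e : e \in G -> [|| e \in H, e \in C | ~~ [disjoint e & S]].
  move=> eG; rewrite inE eG /= -disjoints_subset.
  by case: [disjoint e & S]; case: (e \in C).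
have degG : (degree G v <= degree H v + (#|S| + #|C|) * n ^ q)%N.
  pose B w := [set e in G | (v \in e) && (w \in e)].
  apply: (@leq_trans (degree H v + (#|C| + #|\bigcup_(w in S) B w|))).
    apply: leq_trans (leq_add (leqnn _) (leq_card_setU _ _).1).
    apply: leq_trans (leq_card_setU _ _).1; apply: subset_leq_card.
    apply/subsetP => e /setIdP[eG ve]; have := split_e e eG.
    rewrite !finset.in_setU; case/or3P => [eH|->|]; rewrite ?orbT //.
      by rewrite [e \in finset _]inE eH ve.
    case/pred0Pn => w /andP[we wS]; apply/orP; right; apply/orP; right.
    by apply/bigcupP; exists w; rewrite ?inE ?eG ?ve.
  have BK w : w \in S -> (#|B w| <= n ^ q)%N.
    move=> wS; have vw : v != w by apply: contraNneq vS => ->.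
    have := card_rsets_through2 q vw; rewrite card_ord; apply: leq_trans.
    apply: subset_leq_card; apply/subsetP => e /setIdP[eG /andP[ve we]].
    by rewrite inE ve we (forall_inP Gr).
  rewrite leq_add2l mulnDl addnC leq_add ?card_bigcup_leq //.
  by rewrite leq_pmulr // expn_gt0 n0.
have cardG : (#|G| <= #|H| + (#|S| + #|C|) * n ^ q.+1)%N.
  pose B w := [set e in G | w \in e].
  apply: (@leq_trans (#|H| + (#|C| + #|\bigcup_(w in S) B w|))).
    apply: leq_trans (leq_add (leqnn _) (leq_card_setU _ _).1).
    apply: leq_trans (leq_card_setU _ _).1; apply: subset_leq_card.
    apply/subsetP => e eG; have := split_e e eG.
    rewrite !finset.in_setU; case/or3P => [->|->|]; rewrite ?orbT //.
    case/pred0Pn => w /andP[we wS]; apply/orP; right; apply/orP; right.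
    by apply/bigcupP; exists w; rewrite ?inE ?eG.
  have BK w : w \in S -> (#|B w| <= n ^ q.+1)%N.
    move=> wS; apply: (@leq_trans 'C(n.-1, q.+1)).
      have := card_rsets_through q.+1 w; rewrite card_ord => <-.
      apply: subset_leq_card; apply/subsetP => e /setIdP[eG we].
      by rewrite inE we (forall_inP Gr).
    by apply: leq_trans (bin_le_expn _ _) _; rewrite leq_exp2r // leq_pred.
  rewrite leq_add2l mulnDl addnC leq_add ?card_bigcup_leq //.
  by rewrite leq_pmulr // expn_gt0 n0.
apply: bounded.
- by apply/forall_inP => e /setIdP[eG _]; rewrite (forall_inP Gr).
- apply: (@le_trans _ _ (degree H v)%:R); last first.
    by rewrite ler_nat /max_degree (@leq_bigmax_cond _ predT (fun v => #|[set e in H | v \in e]|)).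
  by move: degG; rewrite -(ler_nat R) natrD natrM natrX; lra.
move: cardG Gex; rewrite -!(ler_nat R) natrD natrM natrX; lra.
Qed.

(** By [turan_succ], going from [n] to [p] vertices loses at most [eta n Y] edges; dividing by [p]
    instead of [n] only raises the average. *)
Lemma ex_avg_degree_drop (R : realType) (r n p : nat) (V : finType)
    (F : {set {set V}}) (eta : R) :
  (0 < p <= n)%N -> (n - p)%:R <= eta * n%:R ->
  ex_avg_degree R r.+1 n F - r.+1%:R * eta * (n%:R ^+ r / r`!%:R)
    <= ex_avg_degree R r.+1 p F.
Proof.
move=> /andP[p0 pn] close; set Y := _ / r`!%:R.
have n0 : 0 < n%:R :> R by rewrite ltr0n; lia.
have Y0 : 0 <= Y by rewrite divr_ge0 ?exprn_ge0.
pose e i : R := (turan_number r.+1 i F)%:R.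
have drop : (n - p)%:R * (- Y) <= - e n - - e p.
  apply: (telescope_ge (u := fun i => - e i)) => // i pi ni.
  have := turan_succ r i F; rewrite -(ler_nat R) natrD -/(e _) -/(e _).
  by have := @bin_le_expr R n i r (ltnW ni); rewrite -/Y; lra.
have gap : e n - e p <= eta * n%:R * Y.
  by have := ler_wpM2r Y0 close; lra.
apply: (@le_trans _ _ (r.+1%:R * e p / n%:R)); last first.
  apply: ler_wpM2l; first by rewrite mulr_ge0.
  by rewrite lef_pV2 ?posrE ?ltr0n ?ler_nat //; lia.
rewrite ler_pdivlMr // mulrBl /ex_avg_degree divfK ?gt_eqF // -/(e n).
by have := ler_wpM2l (ler0n R r.+1) gap; lra.
Qed.

(** * Choice of constants and conclusion *)

(** [e] stands for [ex(n, F)]. Each bound on [t] reads [t X_i <= n] or [t n ^ q.+1 X_i <= e], and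
    the latter kind implies the former as [e <= n ^ q.+2]; so [delta] is the inverse of the sum of
    the [X_i]. *)
Lemma choose_delta (R : realType) (m q f N : nat) (eta c1 c2 : R) :
  0 < eta -> 0 < c1 -> 0 < c2 ->
  exists (delta : R) (N0 : nat), 0 < delta /\
    forall (n t : nat) (e : R), (N0 <= n)%N -> (0 < t)%N ->
      e <= n%:R ^+ q.+2 -> t%:R <= delta * e / n%:R ^+ q.+1 ->
      [/\ (N < n)%N, q.+2%:R <= eta * n%:R, t%:R * (2 * m%:R + 1) <= eta * n%:R,
          (t * (4 * m.+1) <= n)%N &
          (3 * (m + 1 + f))%:R * t%:R * n%:R ^+ q.+1 <= c2 * e /\
          (3 * (m + 1 + f))%:R * t%:R * (2 * (q.+1)`!%:R) <= c1 * n%:R].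
Proof.
move=> eta0 c1_0 c2_0.
have K0 : 0 <= (3 * (m + 1 + f))%:R :> R by [].
move: (3 * (m + 1 + f))%:R K0 => K K0.
have fq0 : 0 <= (q.+1)`!%:R :> R by [].
move: (q.+1)`!%:R fq0 => fq fq0.
pose X1 := (2 * m%:R + 1) / eta; pose X2 := K / c2.
pose X3 := K * (2 * fq) / c1; pose X4 := (4 * m.+1)%:R : R.
have X1_0 : 0 <= X1 by rewrite divr_ge0 ?addr_ge0 ?mulr_ge0 // ltW.
have X2_0 : 0 <= X2 by rewrite divr_ge0 // ltW.
have X3_0 : 0 <= X3 by rewrite divr_ge0 ?mulr_ge0 // ltW.
have X4_0 : 0 < X4 by rewrite ltr0n.
pose X := X1 + X2 + X3 + X4.
have [X1X X2X X3X X4X] : [/\ X1 <= X, X2 <= X, X3 <= X & X4 <= X].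
  by rewrite /X; split; lra.
have X_0 : 0 < X by apply: lt_le_trans X4X.
have [N1 N1P] : exists N1 : nat, q.+2%:R / eta < N1%:R.
  by exists (Num.bound (q.+2%:R / eta)); apply: archi_boundP; rewrite divr_ge0 // ltW.
exists X^-1, (N + N1).+1; split; first by rewrite invr_gt0.
move=> n t e Nn t0 e_n t_le.
have [Nn' N1n] : (N < n)%N /\ (N1 <= n)%N by move: Nn; clear; lia.
have n0 : 0 < n%:R :> R by rewrite ltr0n (leq_ltn_trans _ Nn').
have nq0 : 0 < n%:R ^+ q.+1 :> R by rewrite exprn_gt0.
have t_ex : t%:R * n%:R ^+ q.+1 * X <= e.
  rewrite -ler_pdivlMr // -ler_pdivlMr //.
  by move: t_le; rewrite [X^-1 * _]mulrC.
have t_n x : x <= X -> t%:R * x <= n%:R.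
  move=> xX; rewrite -(ler_pM2l nq0) -exprSr; apply: le_trans e_n.
  apply: le_trans t_ex; rewrite mulrCA mulrA.
  by apply: ler_wpM2l => //; rewrite mulr_ge0 // ltW.
split=> //.
- rewrite mulrC -ler_pdivrMr // ltW //.
  by apply: lt_le_trans N1P _; rewrite ler_nat.
- by have := t_n _ X1X; rewrite /X1 mulrA ler_pdivrMr // mulrC [n%:R * _]mulrC.
- by rewrite -(ler_nat R) natrM; apply: t_n.
split.
  rewrite [leRHS]mulrC -ler_pdivrMr //; apply: le_trans t_ex.
  have -> : K * t%:R * n%:R ^+ q.+1 / c2 = t%:R * n%:R ^+ q.+1 * X2.
    by rewrite /X2; ring.
  by apply: ler_wpM2l => //; rewrite mulr_ge0 // ltW.
have := t_n _ X3X; have -> : t%:R * X3 = K * t%:R * (2 * fq) / c1.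
  by rewrite /X3; ring.
by rewrite ler_pdivrMr // [n%:R * _]mulrC.
Qed.

Theorem theorem1p3 (R : realType) (r : nat) (V : finType) (F : {set {set V}})
    (c1 c2 : R) :
  (2 <= r)%N ->
  is_rgraph r F ->
  smooth R r F ->
  bounded_graph r F c1 c2 ->
  0 < c1 ->
  c1 <= (1 - turan_density R r F) / (12%:R * #|V|%:R) ->
  0 < c2 ->
  exists (delta : R) (N0 : nat), 0 < delta /\
    forall n t : nat, (N0 <= n)%N ->
      t%:R <= delta * (turan_number r n F)%:R / (n%:R ^+ r.-1) ->
      ar r n (copies t.+2 F)
        = ('C(n, r) - 'C(n - t, r) + ar r (n - t) (copies 2 F))%N.
Proof.
case: r => [|[|q]] // _ Fr smoothF [Nb Hbound] c1_0 c1_le c2_0.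
(* For empty [V] the bound on [c1] is a division by zero, equal to [0], against [0 < c1]. *)
have m0 : (0 < #|V|)%N.
  by rewrite lt0n; apply: contraTneq c1_le => ->; rewrite mulr0 invr0 mulr0 -ltNge.
have m1 : 1 <= #|V|%:R :> R by rewrite ler1n.
have F_ne0 : {in F, forall e, e != finset.set0}.
  by move=> e eF; rewrite -card_gt0 (eqP (forall_inP Fr _ eF)).
have [Ns Hs] := smooth_increment smoothF m0.
have [a piE] : exists a, turan_density R q.+2 F = 1 - a.
  by exists (1 - turan_density R q.+2 F); lra.
have a_le1 : a <= 1 by have := @turan_density_ge0 R q.+2 V F; rewrite piE; lra.
have aE : 1 - (1 - a) = a by lra.
rewrite piE aE in c1_le Hs.
have c1m : c1 * (12 * #|V|%:R) <= a by rewrite -ler_pdivlMr // mulr_gt0 // ltr0n.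
have a0 : 0 < a by apply: lt_le_trans c1m; rewrite !mulr_gt0 // ltr0n.
have ep0 : 0 < a / 32 by lra.
have [Nd Hd] := @turan_le_density R q.+2 V F _ ep0.
have r1 : 2 <= q.+2%:R :> R by rewrite ler_nat.
have mr0 : 0 < 64 * #|V|%:R * q.+2%:R :> R by rewrite !mulr_gt0 // ltr0n.
(* [eta] bounds the fraction of vertices deleted. The factor 64 gives [2 r eta <= a / 32], covering
   the loss in [bin_ge_expr], and [2 m r eta + 2 (a / 32) = 3 a / 32], below the [7 a / 24] of
   [count_ineq]. *)
have [eta eta0 etaE] : exists2 eta : R, 0 < eta & 64 * #|V|%:R * q.+2%:R * eta = a.
  exists (a / (64 * #|V|%:R * q.+2%:R)); first by rewrite divr_gt0.
  by rewrite mulrC divfK // gt_eqF.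
have reta0 : 0 <= q.+2%:R * eta by rewrite mulr_ge0 // ltW.
have eta_r : 64 * (q.+2%:R * eta) <= a.
  by rewrite -etaE -!mulrA ler_pM2l // ler_peMl.
have eta_r1 : 2 * eta <= q.+2%:R * eta by rewrite ler_pM2r.
have eta_q : q.+1%:R * eta <= q.+2%:R * eta by rewrite ler_pM2r // ler_nat.
have [delta [N0 [delta0 Hdelta]]] :=
  @choose_delta R #|V| q #|F| (2 * (Nb + Ns + Nd + #|V| + q.+2)) eta c1 c2 eta0 c1_0 c2_0.
exists delta, N0; split=> // n t N0n /=; have [->|t0] := posnP t.
  by move=> _; rewrite subn0 subnn.
move=> t_le.
have [] := Hdelta n t (turan_number q.+2 n F)%:R N0n t0 _ t_le.
  by rewrite -natrX ler_nat (leq_trans (turan_le_bin _ _ _)) // bin_le_expn.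
move=> Nn r_eta tA tJ [tK1 tK2]; clear Hdelta.
have n0 : 0 < n%:R :> R by rewrite ltr0n (leq_ltn_trans _ Nn).
have nq0 : 0 < n%:R ^+ q.+1 :> R by rewrite exprn_gt0.
(* A zero Turán number would allow only [t = 0]; positivity then gives [F] two edges. *)
have turan_gt0 : (0 < turan_number q.+2 n F)%N.
  rewrite lt0n; apply: contraTneq t_le => ->.
  by rewrite mulr0 mul0r -ltNge ltr0n.
have Vn : (#|V| <= n)%N by move: Nn; clear; lia.
have F1 := turan_gt0_card Fr Vn turan_gt0.
have Jn : (t.+2 * #|V|.+1 + #|V| <= n)%N by move: t0 tJ; clear; nia.
have rtn : (q.+2 + t.+1 <= n)%N by move: t0 tJ m0 Nn; clear; nia.
have fq0 : 0 < (q.+1)`!%:R :> R by rewrite ltr0n fact_gt0.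
have [Y YE] : exists Y : R, n%:R ^+ q.+1 / (q.+1)`!%:R = Y by exists (n%:R ^+ q.+1 / (q.+1)`!%:R).
have Y0 : 0 <= Y by rewrite -YE divr_ge0 // ltW.
have binY p : (p <= n)%N -> 'C(p, q.+1)%:R <= Y.
  by rewrite -YE; apply: bin_le_expr.
have binYge p : (1 - eta) * n%:R <= p%:R -> (1 - a / 32) * Y <= 'C(p, q.+1)%:R.
  move=> pn; rewrite -YE; apply: le_trans (@bin_ge_expr R n p q.+1 eta _ _ pn _).
  - by rewrite YE; apply: ler_wpM2r => //; lra.
  - exact: ltW.
  - lra.
  - by apply: le_trans r_eta; rewrite ler_nat.
have half_Y : Y <= 2 * 'C(n.-1, q.+1)%:R.
  have : (1 - a / 32) * Y <= 'C(n.-1, q.+1)%:R.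
    apply: binYge; rewrite -subn1 natrB ?(leq_ltn_trans _ Nn) //; lra.
  have : (1 / 2) * Y <= (1 - a / 32) * Y by apply: ler_wpM2r => //; lra.
  lra.
(* The factor 3 comes from [t + 2 <= 3 t] for [t >= 1]. *)
have J_le : (t.+2 * #|V|.+1 + t.+2 * #|F| <= 3 * (#|V| + 1 + #|F|) * t)%N.
  by move: t0; clear; nia.
move: (3 * (#|V| + 1 + #|F|))%N J_le tK1 tK2 => K J_le tK1 tK2.
(* At most half of the vertices are deleted, so every order [p] that occurs is at least [n / 2] and
   exceeds all thresholds. *)
have nat_n : [/\ (Nb <= n)%N & ((2 * #|V| + 1) * t <= n)%N /\
    forall p, (n - (2 * #|V| + 1) * t <= p)%N -> [/\ (Ns <= p)%N, (Nd < p)%N & (0 < p)%N]].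
  have : (2 * ((2 * #|V| + 1) * t) <= n)%N by apply: leq_trans tJ; clear; nia.
  move: ((2 * #|V| + 1) * t)%N Nn; clear => M Nn M2.
  by split; [lia | split=> [|p pM]; [lia | split; lia]].
have [Nbn [Mn Np]] := nat_n.
have close p : (n - (2 * #|V| + 1) * t <= p)%N -> (n - p)%:R <= eta * n%:R.
  move=> pM; apply: le_trans tA.
  rewrite -[1]/(1%:R) -natrM -natrD -natrM ler_nat.
  by move: pM; clear; lia.
(* In [D] one [c1] serves boundedness and the other pays for deleted edges; [12 m c1 <= a] turns
   [2 c1] into the [a / (6 m)] of [count_ineq]. *)
apply: (@ar_copies_eq R q.+1 n t V F
    (ex_avg_degree R q.+2 n F + 2 * c1 * 'C(n.-1, q.+1)%:R)) => //.
  move=> G v S C Gr Gex Gv vS cardS cardC.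
  have cardSC : (#|S| + #|C|)%:R <= K%:R * t%:R :> R.
    by rewrite -natrM ler_nat (leq_trans _ J_le) // leq_add.
  apply: (@contains_off_set R q n V F c1 c2 G v S C _ Gr Gex Gv vS).
  - by move=> H Hr; have := Hbound 'I_n H; rewrite /= card_ord; apply.
  - apply: (@le_trans _ _ (K%:R * t%:R * n%:R ^+ q)).
      by apply: ler_wpM2r => //; apply: exprn_ge0.
    apply: (@le_trans _ _ (c1 * (Y / 2))); last by rewrite ler_pM2l //; lra.
    rewrite -(ler_pM2r n0) -(ler_pM2r (_ : 0 < 2 * (q.+1)`!%:R)); last by rewrite mulr_gt0.
    have -> : c1 * (Y / 2) * n%:R * (2 * (q.+1)`!%:R) = c1 * n%:R * n%:R ^+ q.+1.
      by rewrite -YE; field; rewrite gt_eqF.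
    have -> : K%:R * t%:R * n%:R ^+ q * n%:R * (2 * (q.+1)`!%:R)
        = K%:R * t%:R * (2 * (q.+1)`!%:R) * n%:R ^+ q.+1 :> R.
      by rewrite exprSr; ring.
    by rewrite ler_pM2r.
  - by apply: le_trans tK1; apply: ler_wpM2r => //; apply: ltW.
move=> l k lt kl.
apply: (@count_ineq R (fun p => (turan_number q.+2 p F)%:R) (fun p => 'C(p, q.+2)%:R)
  (fun p => ex_avg_degree R q.+2 p F) a (q.+2%:R * eta) (a / 32) Y _ #|V| n t l k m0 lt kl) => //.
- exact: ltW.
- by rewrite -etaE; lra.
- rewrite lerD2l; apply: ler_pM => //.
  + by rewrite mulr_ge0 // ltW.
  + by rewrite ler_pdivlMr ?mulr_gt0 // ?ltr0n //; lra.
  + exact/binY/leq_pred.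
- move=> p pM pn; have [Nsp _ _] := Np p pM; apply: le_trans (Hs p Nsp) _.
  apply: ler_wpM2l; first by rewrite divr_ge0 ?mulr_ge0 // ltW.
  exact: binY.
- move=> p pM pn; rewrite -YE; apply: ex_avg_degree_drop; last exact: close.
  by have [_ _ ->] := Np p pM; apply: ltnW.
- move=> p pM pn; have [_] := Np p pM; case: p pM pn => // p pM pn Ndp _.
  have le_d : ex_avg_degree R q.+2 p.+1 F <= (1 - a + a / 32) * 'C(p, q.+1)%:R.
    by apply: ex_avg_degree_le; rewrite -piE; apply: Hd; apply: ltnW.
  apply: le_trans le_d _; apply: ler_wpM2l; first by lra.
  by apply: binY; apply: ltnW; apply: ltnW.
move=> p pM pn; rewrite binS natrD addrAC subrr add0r; apply: binYge.
by have := close p pM; rewrite natrB; [lra | exact: ltnW].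
Qed.
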